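(* Let $0<\tau\le L$, $\mathcal{B}=\mathbb{R}^n$, and let $\kappa\ge1$, $\mu>0$, $0<\delta_0\le1/2$. For every $f\in\mathcal{F}_{\tau,L,\mathcal{B}}$ let $C_f$ be a function comparison oracle with parameters $(\kappa,\mu,\delta_0)$. Then there exists a coordinate-descent algorithm, which does not need to know $\kappa$, that outputs an estimate $\widehat{x}_T$ after $T$ function comparison queries such that, with probability at least $1-\delta$, \[ \sup_{f \in\mathcal{F}_{\tau,L,\mathcal{B}}} \mathbb{E} \left[ f(\widehat{x}_T) - f(x_f^* ) \right] \leq \begin{cases} c_1\exp\left\{ -c_2 \sqrt{ \frac{T}{n } }\right\} & \text{ if } \kappa = 1, \\ c_3\, n\left( \frac{n }{T} \right)^{\frac{1}{ 2 (\kappa-1)}} & \text{ if } \kappa > 1, \end{cases} \] where $c_1,c_2,c_3$ depend on the oracle and function class parameters and depend on $T$, $n$ and $1/\delta$ only poly-logarithmically.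
   Context: A function $f$ is strongly convex with constant $\tau>0$ on a convex set $\mathcal{B}\subset\mathbb{R}^n$ if $f(y)\ge f(x)+\langle\nabla f(x),y-x\rangle+\frac{\tau}{2}\|x-y\|^2$ for all $x,y\in\mathcal{B}$; its gradient is Lipschitz with constant $L$ if $\|\nabla f(x)-\nabla f(y)\|\le L\|x-y\|$. $\mathcal{F}_{\tau,L,\mathcal{B}}$ denotes the class of functions that are strongly convex with constant $\tau$ on $\mathcal{B}$, have $L$-Lipschitz gradients, and attain their minimum in $\mathcal{B}$; $x_f^*$ denotes the minimizer of $f$. A function comparison oracle for $f$ with parameters $(\kappa,\mu,\delta_0)$ returns, for any queried pair $x,y$, a binary random variable $C_f(x,y)\in\{-1,1\}$ (independently across queries given the queried points) satisfying $\mathbb{P}\left( C_f(x,y) =\mathrm{sign}\{ f(y)-f(x) \} \right) \geq \frac{1}{2}+ \min\left\{ \delta_0, \mu |f(y)-f(x)|^{\kappa-1} \right\}$; when $\kappa=1$ it is assumed that $\mu\le\delta_0\le1/2$. A coordinate-descent algorithm here is one that at each iteration picks a coordinate direction $\mathbf{e}_i$ uniformly at random and moves the current iterate along it by a step determined through oracle queries. The expectation is over the randomness of the algorithm and oracle.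
   Formalization: A known bound Rad on the distance from the starting point to x_f^* is added (without it the supremum is infinite) and the algorithm and constants may depend on it; ''with probability 1-δ, E[...]'' is read as f(x_T)-f(x_f^* ) being within the bound with probability at least 1-δ; ties are unconstrained. *)

(* Defs.v *)
From HB Require Import structures.
From mathcomp Require Import all_boot all_order all_algebra.
From mathcomp Require Import all_classical all_reals all_analysis.
Set Implicit Arguments. Unset Strict Implicit. Unset Printing Implicit Defensive.
Import Order.TTheory GRing.Theory Num.Theory.
Import numFieldNormedType.Exports.
Local Open Scope ring_scope.

Section Defs.
Variable R : realType.
Variable n : nat.
Local Notation vec := 'rV[R]_n.

Definition dotv (u v : vec) : R := \sum_(i < n) u 0 i * v 0 i.
Definition enorm (v : vec) : R := Num.sqrt (dotv v v).

Definition evec (i : 'I_n) : vec := delta_mx 0 i.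

Definition is_gradient (f : vec -> R) (g : vec -> vec) : Prop :=
  forall x, differentiable f x /\ forall v, 'd f x v = dotv (g x) v.

Definition is_minimizer (f : vec -> R) (xs : vec) : Prop :=
  forall y, f xs <= f y.

Definition in_class (tau L : R) (f : vec -> R) : Prop :=
  exists g : vec -> vec,
    [/\ is_gradient f g,
        (forall x y, f x + dotv (g x) (y - x) + tau / 2 * enorm (x - y) ^+ 2 <= f y),
        (forall x y, enorm (g x - g y) <= L * enorm (x - y)) &
        exists xs, is_minimizer f xs].

(* A function comparison oracle for f with parameters (kappa, mu, delta0):
   q x y is the probability that C_f(x,y) = +1 (the responses are
   independent across queries given the queried points).
   C_f(x,y) = sign(f y - f x) means C = +1 iff f x < f y.
   The accuracy condition is imposed when f x <> f y. *)
Definition comparison_oracle (kappa mu delta0 : R) (f : vec -> R)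
    (q : vec -> vec -> R) : Prop :=
  (forall x y, 0 <= q x y <= 1) /\
  (forall x y, f x != f y ->
     1 / 2 + Num.min delta0 (mu * `|f y - f x| `^ (kappa - 1))
       <= (if f x < f y then q x y else 1 - q x y)).

(* History of a run: coordinates drawn and oracle responses (true = +1). *)
Inductive event := Coord of 'I_n | Resp of bool.

(* A coordinate-descent algorithm.  Every iteration draws a coordinate i
   uniformly at random, issues one mandatory query (cd_first) and then
   further adaptive queries (cd_more returns None to end the iteration);
   at the end of the iteration the iterate moves to x + (cd_step h) e_i.
   All choices may depend on the whole history h (the iterate itself is
   a deterministic function of the history). *)
Record cd_alg := CDAlg {
  cd_x0 : vec;
  cd_first : seq event -> vec * vec;
  cd_more : seq event -> option (vec * vec);
  cd_step : seq event -> R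
}.

Section Run.
Variables (A : cd_alg) (q : vec -> vec -> R) (P : vec -> R).

(* Expected value of P(final iterate) when b queries remain, just after
   an oracle response was appended to the history h; x is the iterate at
   the start of the current iteration, i its coordinate. *)
Fixpoint run (b : nat) (h : seq event) (x : vec) (i : 'I_n) : R :=
  match b with
  | 0 => P (x + cd_step A h *: evec i)
  | b'.+1 =>
    match cd_more A h with
    | Some (u, v) =>
        q u v * run b' (rcons h (Resp true)) x i
        + (1 - q u v) * run b' (rcons h (Resp false)) x i
    | None =>
        let x' := x + cd_step A h *: evec i in
        n%:R^-1 * \sum_(j < n)
          (let h1 := rcons h (Coord j) in
           let uv := cd_first A h1 in
           q uv.1 uv.2 * run b' (rcons h1 (Resp true)) x' j
           + (1 - q uv.1 uv.2) * run b' (rcons h1 (Resp false)) x' j)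
    end
  end.

(* Expected value of P(x_T) for a run with exactly T >= 1 queries. *)
Definition run_expect (T : nat) : R :=
  n%:R^-1 * \sum_(j < n)
    (let h1 := [:: Coord j] in
     let uv := cd_first A h1 in
     q uv.1 uv.2 * run T.-1 (rcons h1 (Resp true)) (cd_x0 A) j
     + (1 - q uv.1 uv.2) * run T.-1 (rcons h1 (Resp false)) (cd_x0 A) j).
End Run.

Definition success_prob (A : cd_alg) (q : vec -> vec -> R) (T : nat)
    (E : vec -> bool) : R :=
  run_expect A q (fun x => (E x)%:R) T.

End Defs.

Arguments evec {R n}.
Arguments success_prob {R n}.
Arguments cd_x0 {R n}.

Definition polylog (R : realType) (p : R) (n T : nat) (delta : R) : R :=
  (1 + ln (n%:R) + ln (T%:R) + ln (1 / delta)) `^ p.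

(* the rate in the theorem, with c1 = a1 * polylog, c2 = a2 / polylog,
   c3 = a3 * polylog *)
Definition rate (R : realType) (kappa a1 a2 a3 p : R) (n T : nat) (delta : R) : R :=
  let l := polylog p n T delta in
  if kappa == 1 then (a1 * l) * expR (- ((a2 / l) * Num.sqrt (T%:R / n%:R)))
  else (a3 * l) * n%:R * (n%:R / T%:R) `^ (1 / (2 * (kappa - 1))).

(* Main.v *)
Require Import Defs.
From HB Require Import structures.
From mathcomp Require Import all_boot all_order all_algebra.
From mathcomp Require Import all_classical all_reals all_analysis.
From mathcomp Require Import zify ring lra.
Set Implicit Arguments. Unset Strict Implicit. Unset Printing Implicit Defensive.
Import Order.TTheory GRing.Theory Num.Theory.
Import numFieldNormedType.Exports.
Local Open Scope ring_scope.

(** Each iteration performs a noisy line search along its coordinate: starting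
from the null step, a running best offset is compared with every point of a
geometric grid, each comparison being the majority of many oracle answers.
Whatever the outcomes, a comparison only errs noticeably when the two values are
closer than a resolution [D], so with high probability the line search loses at
most [D] per comparison, and otherwise gains the decrease [g_j^2 / (8 L)] of a
gradient step. Averaging over the coordinates and using strong convexity, the gap
contracts by [1 - tau / (4 L n)] per iteration up to the accumulated loss.

Adaptivity to [kappa] comes from running two phases. The first one uses few votes
and a fine grid: for [kappa = 1] it has resolution 0 and yields the exponential
rate, and for [kappa > 1] it has resolution 1 and cannot increase the gap by more
than [T]. The second one uses about [T / n] votes on [polylog] iterations per
coordinate: for [kappa = 1] it is harmless, and for [kappa > 1] its resolution is
of order [(n / T)^(1 / (2 (kappa - 1)))]. *)

Lemma le_of_eq {R : realType} (x y : R) : x = y -> x <= y.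
Proof. by move=> ->. Qed.

(** * The scheduled line-search algorithm and its expected outcome *)

Section Algorithm.
Context {R : realType} {n : nat}.
Local Notation vec := 'rV[R]_n.

Definition oevec (oi : option 'I_n) : vec := if oi is Some i then evec i else 0.

(** Halving is fine enough: a step within a factor two of the ideal one keeps a fixed share of the
    gain. Both signs occur because the sign of the partial derivative is unknown. *)
Definition grid (s0 : R) (J : nat) : seq R :=
  [seq s0 / 2 ^+ j.+1 | j <- iota 0 J] ++ [seq - (s0 / 2 ^+ j.+1) | j <- iota 0 J].

(* [st_left] is one less than the number of votes still to be cast in the
   current comparison; [st_false] counts its negative votes. *)
Record state := State {
  st_x : vec;
  st_coord : option 'I_n;
  st_best : R;
  st_cands : seq R;
  st_half : nat;
  st_left : nat;
  st_false : nat;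
  st_sched : seq (nat * nat)
}.

Definition st_query (z : state) : option (vec * vec) :=
  if st_cands z is c :: _ then
    Some (st_x z + st_best z *: oevec (st_coord z), st_x z + c *: oevec (st_coord z))
  else None.

(** Once the schedule is exhausted, dummy queries use up the budget; [st_upd] ignores their answers
    because no candidate is left. *)
Definition st_more (z : state) : option (vec * vec) :=
  if st_query z is Some uv then Some uv
  else if st_sched z is [::] then Some (0, 0) else None.

Definition st_upd (s0 : R) (z : state) (ev : event n) : state :=
  match ev with
  | Coord j =>
      let x := st_x z + st_best z *: oevec (st_coord z) in
      if st_sched z is (J, H) :: s
      then State x (Some j) 0 (grid s0 J) H (2 * H).-1 0 s
      else State x (Some j) 0 [::] 0 0 0 [::]
  | Resp r =>
      if st_cands z is c :: cs then
        let fc := (st_false z + ~~ r)%N in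
        if st_left z is v.+1
        then State (st_x z) (st_coord z) (st_best z) (c :: cs) (st_half z) v fc (st_sched z)
        else State (st_x z) (st_coord z) (if (st_half z <= fc)%N then c else st_best z)
               cs (st_half z) (2 * st_half z).-1 0 (st_sched z)
      else z
  end.

Definition state_of (s0 : R) (sched : seq (nat * nat)) (h : seq (event n)) : state :=
  foldl (st_upd s0) (State 0 None 0 [::] 0 0 0 sched) h.

Definition sched_alg (s0 : R) (sched : seq (nat * nat)) : cd_alg R n :=
  CDAlg 0 (fun h => odflt (0, 0) (st_query (state_of s0 sched h)))
    (fun h => st_more (state_of s0 sched h))
    (fun h => st_best (state_of s0 sched h)).

(* Expectation of [F] of the number of negative votes, [s] counted so far and
   [v] to come, each positive with probability [p]. *)
Fixpoint votes (p : R) (F : nat -> R) (v s : nat) : R :=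
  if v is v'.+1 then p * votes p F v' s + (1 - p) * votes p F v' s.+1 else F s.

Section Expectations.
Variable q : vec -> vec -> R.

(** Continuation style: [K] is the value of the rest of the run as a function of the selected
    offset, so that line searches compose. A negative vote speaks for the candidate [c], which also
    wins ties. *)
Fixpoint tour (H : nat) (x e : vec) (K : R -> R) (cs : seq R) (best : R) : R :=
  if cs is c :: cs' then
    votes (q (x + best *: e) (x + c *: e))
      (fun s => if (H <= s)%N then tour H x e K cs' c else tour H x e K cs' best)
      (2 * H) 0
  else K best.

Fixpoint sched_exp (s0 : R) (P : vec -> R) (sched : seq (nat * nat)) (x : vec) : R :=
  if sched is (J, H) :: s then
    n%:R^-1 * \sum_(j < n)
      tour H x (evec j) (fun t => sched_exp s0 P s (x + t *: evec j)) (grid s0 J) 0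
  else P x.

Definition cost (sched : seq (nat * nat)) : nat :=
  sumn [seq (2 * jh.1) * (2 * jh.2) | jh <- sched]%N.

Definition valid (sched : seq (nat * nat)) : bool :=
  all (fun jh => (0 < jh.1)%N && (0 < jh.2)%N) sched.

Lemma size_grid s0 J : size (grid s0 J) = (2 * J)%N.
Proof. by rewrite size_cat !size_map size_iota mul2n addnn. Qed.

Variables (s0 : R) (sched0 : seq (nat * nat)) (P : vec -> R).
Local Notation A := (sched_alg s0 sched0).
Local Notation stof := (state_of s0 sched0).
Local Notation run := (@run R n A q P).

Lemma state_of_rcons h ev : stof (rcons h ev) = st_upd s0 (stof h) ev.
Proof. by rewrite /state_of foldl_rcons. Qed.

(** Both answers to a dummy query lead to the same state, so their weights add up to 1. *)
Lemma run_done b h x i best H v s :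
  stof h = State x (Some i) best [::] H v s [::] -> run b h x i = P (x + best *: evec i).
Proof.
elim: b h => [|b IH] h hE /=; rewrite hE //=.
by rewrite !IH ?state_of_rcons ?hE //= -mulrDl addrC subrK mul1r.
Qed.

Lemma run_votes b x i best c cs H sched (K : bool -> R) :
  (forall d h, stof h = State x (Some i) (if d then c else best) cs H (2 * H).-1 0 sched ->
     run b h x i = K d) ->
  forall v s h, stof h = State x (Some i) best (c :: cs) H v s sched ->
  run (v.+1 + b) h x i =
  votes (q (x + best *: evec i) (x + c *: evec i)) (fun s => K (H <= s)%N) v.+1 s.
Proof.
move=> HK; elim=> [|v IH] s h hE.
  rewrite add1n /= hE /=; congr (_ * _ + _ * _); apply: HK;
    by rewrite state_of_rcons hE /= ?addn0 ?addn1.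
have {}IH s' h' := IH s' h'; set w := v.+1 in IH *.
rewrite addSn; set b' := (w + b)%N in IH *; rewrite /= hE /=.
by congr (_ * _ + _ * _); apply: IH; rewrite state_of_rcons hE /= ?addn0 ?addn1.
Qed.

Lemma run_tour b x i H sched (K : R -> R) : (0 < H)%N ->
  (forall t h, stof h = State x (Some i) t [::] H (2 * H).-1 0 sched -> run b h x i = K t) ->
  forall cs best h, stof h = State x (Some i) best cs H (2 * H).-1 0 sched ->
  run (size cs * (2 * H) + b) h x i = tour H x (evec i) K cs best.
Proof.
move=> H0 HK; elim=> [|c cs IH] best h hE; first exact: (HK _ _ hE).
rewrite mulSn -addnA /=; have vE : (2 * H = (2 * H).-1.+1)%N by lia.
rewrite [X in (X + _)%N]vE [X in votes _ _ X]vE.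
have HKd d h' : stof h' = State x (Some i) (if d then c else best) cs H (2 * H).-1 0 sched ->
    run (size cs * (2 * H) + b) h' x i = tour H x (evec i) K cs (if d then c else best).
  exact: IH.
rewrite (run_votes (K := fun d => tour H x (evec i) K cs (if d then c else best)) HKd hE).
by congr (votes _ _ _ _); apply/funext => s; case: leqP.
Qed.

Lemma run_sched b sched x i best H v s h : valid sched ->
  stof h = State x (Some i) best [::] H v s sched ->
  run (cost sched + b) h x i = sched_exp s0 P sched (x + best *: evec i).
Proof.
elim: sched x i best H v s h => [|[J H'] sched IH] x i best H v s h.
  by move=> _; exact: run_done.
rewrite /= => /andP[/andP[/= J0 H0] vs] hE.
have -> : (cost ((J, H') :: sched) + b =
  ((2 * J) * (2 * H') + (cost sched + b)).-1.+1)%N by rewrite /cost /=; lia.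
rewrite /= hE /=; congr (_ * _); apply: eq_bigr => j _.
rewrite -(@run_tour (cost sched + b) _ j H' sched _ H0 _ _ 0 (rcons h (Coord j))) //=; last 2 first.
- by move=> t h' h'E; rewrite (IH _ _ _ _ _ _ _ vs h'E).
- by rewrite state_of_rcons hE.
rewrite size_grid.
(* Drawing the coordinate costs no query: [cd_first] issues the first vote of the line search, so
   one unfolding of [run] on the right matches the opening of the iteration on the left. *)
have -> : (2 * J * (2 * H') + (cost sched + b) =
  (2 * J * (2 * H') + (cost sched + b)).-1.+1)%N by lia.
rewrite [in RHS]/= /st_more state_of_rcons hE /=.
by have := size_grid s0 J; case: (grid s0 J) => [|c cs] //=; lia.
Qed.

(** Bridge from the query-by-query semantics to the schedule: the remaining analysis only has to
    estimate [sched_exp]. *)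
Lemma run_expect_sched T : (0 < n)%N -> (0 < T)%N -> valid sched0 -> (cost sched0 <= T)%N ->
  run_expect A q P T = sched_exp s0 P sched0 0.
Proof.
move=> n0 T0; have nn : n%:R != 0 :> R by rewrite pnatr_eq0; lia.
have E0 : stof [::] = State 0 None 0 [::] 0 0 0 sched0 by [].
have EC j : stof [:: Coord j] = st_upd s0 (stof [::]) (Coord j) by [].
rewrite /run_expect; case sE: sched0 => [|[J H] sched].
  move=> _ _ /=; transitivity (n%:R^-1 * \sum_(j < n) P 0); last first.
    by rewrite sumr_const card_ord -[P 0 *+ n]mulr_natl mulrA mulVf // mul1r.
  congr (_ * _); apply: eq_bigr => j _.
  have E r : stof [:: Coord j; Resp n r] = State 0 (Some j) 0 [::] 0 0 0 [::].
    rewrite -[[:: Coord j; _]]/(rcons [:: Coord j] (Resp n r)) state_of_rcons EC E0 /= sE /=.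
    by rewrite scaler0 addr0.
  rewrite -sE !(run_done _ (E _)) /= -mulrDl addrC subrK mul1r.
  by rewrite scale0r addr0.
rewrite [X in is_true X -> _]/= => /andP[/andP[/= J0 H0] vs] cT.
have [b TE] : exists b, (T = (2 * J) * (2 * H) + (cost sched + b))%N.
  by exists (T - cost sched0)%N; move: cT; rewrite sE /cost /=; lia.
congr (_ * _); apply: eq_bigr => j _.
have Ej : stof [:: Coord j] = State 0 (Some j) 0 (grid s0 J) H (2 * H).-1 0 sched.
  by rewrite EC E0 /= sE /= scaler0 addr0.
rewrite -sE -(@run_tour (cost sched + b) 0 j H sched _ H0 _ _ 0 [:: Coord j]) //; last first.
  by move=> t h' h'E; exact: (run_sched _ vs h'E).
rewrite size_grid -TE; case: T T0 {TE cT} => // T' _.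
rewrite /= /st_more Ej /=.
by have := size_grid s0 J; case: (grid s0 J) => [|c cs] //=; lia.
Qed.

End Expectations.
End Algorithm.

(** * Majority votes and their error probability *)

Section Votes.
Context {R : realType}.
Implicit Types (p g a b : R) (F : nat -> R).

Lemma votes_compl p F v s : votes p (fun s => 1 - F s) v s = 1 - votes p F v s.
Proof. by elim: v s => [|v IH] s //=; rewrite !IH; ring. Qed.

Lemma votes_ge0 p F v s : 0 <= p <= 1 -> (forall s, 0 <= F s) -> 0 <= votes p F v s.
Proof. by move=> /andP[p0 p1] F0; elim: v s => [|v IH] s //=; rewrite addr_ge0 ?mulr_ge0 ?subr_ge0. Qed.

Lemma votes_le p F B v s : 0 <= p <= 1 -> (forall s, F s <= B) -> votes p F v s <= B.
Proof.
move=> /andP[p0 p1] FB; elim: v s => [|v IH] s //=.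
have := ler_wpM2l p0 (IH s); have p1' : 0 <= 1 - p by lra.
by have := ler_wpM2l p1' (IH s.+1); lra.
Qed.

Lemma votes_if p H a b v s :
  votes p (fun s => if (H <= s)%N then a else b) v s =
  votes p (fun s => (H <= s)%N%:R) v s * a + (1 - votes p (fun s => (H <= s)%N%:R) v s) * b.
Proof.
elim: v s => [|v IH] s /=; last by rewrite !IH; ring.
by case: (H <= s)%N; rewrite ?mulr1n ?mulr0n; ring.
Qed.

(** One more vote multiplies the weight [a ^+ s * b ^+ t] on average by [p * b + (1 - p) * a]; a
    pointwise bound on [F] by the weight thus becomes a bound in expectation. *)
Lemma votes_potential p F a b C m v s t : 0 <= p <= 1 -> 0 <= a -> 0 <= b -> 0 <= C ->
  (forall s t, (s + t = m)%N -> F s <= C * a ^+ s * b ^+ t) -> (v + s + t = m)%N ->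
  votes p F v s <= C * a ^+ s * b ^+ t * (p * b + (1 - p) * a) ^+ v.
Proof.
move=> /andP[p0 p1] a0 b0 C0 FC; elim: v s t => [|v IH] s t vst /=.
  by rewrite expr0 mulr1; apply: FC.
have vst1 : (v + s + t.+1 = m)%N by lia.
have vst2 : (v + s.+1 + t = m)%N by lia.
have := ler_wpM2l p0 (IH _ _ vst1); have p1' : 0 <= 1 - p by lra.
have := ler_wpM2l p1' (IH _ _ vst2); rewrite !exprS => h2 h1.
apply: le_trans (lerD h1 h2) _; set E := _ ^+ v.
by apply: le_of_eq; ring.
Qed.

(* Chernoff bound: a correct vote is weighted by [1 - g], a wrong one by [1 + g]. *)
Lemma votes_majority p g H : 0 <= p <= 1 -> 0 <= g <= 1 / 2 ->
  (1 / 2 + g <= p -> votes p (fun s => (H <= s)%N%:R) (2 * H) 0 <= (1 - g ^+ 2) ^+ (3 * H)) /\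
  (p <= 1 / 2 - g -> 1 - votes p (fun s => (H <= s)%N%:R) (2 * H) 0 <= (1 - g ^+ 2) ^+ (3 * H)).
Proof.
move=> p01 /andP[g0 g1].
have G0 : 0 < 1 - g ^+ 2 by nra.
(* Each vote contributes at most [1 - 2 * g ^+ 2 <= (1 - g ^+ 2) ^+ 2], hence the exponent [4 * H]
   for [2 * H] votes; dividing by [(1 - g ^+ 2) ^+ H] leaves [3 * H]. *)
have key a b : 0 <= a -> 0 <= b -> a * b = 1 - g ^+ 2 -> p * b + (1 - p) * a <= 1 - 2 * g ^+ 2 ->
  ((1 - g ^+ 2) ^+ H)^-1 * a ^+ 0 * b ^+ 0 * (p * b + (1 - p) * a) ^+ (2 * H) <= (1 - g ^+ 2) ^+ (3 * H).
  move=> a0 b0 ab le; rewrite !expr0 !mulr1 ler_pdivrMl ?exprn_gt0 // -exprD.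
  have -> : (H + 3 * H = 2 * (2 * H))%N by lia.
  rewrite [X in _ <= X]exprM; apply: lerXn2r; rewrite ?nnegrE.
  - by case/andP: p01 => p0 p1; rewrite addr_ge0 ?mulr_ge0 ?subr_ge0.
  - by rewrite exprn_ge0 // ltW.
  - by apply: le_trans le _; nra.
(* With at least [H] wrong votes, [a ^+ s * b ^+ t] is at least [(a * b) ^+ H], so the normalised
   weight dominates the indicator of a wrong majority. *)
have pw (a b : R) s t : 0 <= b -> b <= a -> a * b = 1 - g ^+ 2 -> (H <= s)%N -> (s + t = 2 * H)%N ->
    1 <= ((1 - g ^+ 2) ^+ H)^-1 * a ^+ s * b ^+ t.
  move=> b0 ba ab Hs st; rewrite -mulrA ler_pdivlMl ?exprn_gt0 // mulr1 -ab exprMn.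
  have [d [-> ->]] : exists d, s = (t + d + d)%N /\ H = (t + d)%N by exists (s - H)%N; lia.
  have a0 : 0 <= a by exact: le_trans ba.
  rewrite !exprD [X in X <= _](_ : _ = (a ^+ t * b ^+ t) * (a ^+ d * b ^+ d)); last by ring.
  rewrite [X in _ <= X](_ : _ = (a ^+ t * b ^+ t) * (a ^+ d * a ^+ d)); last by ring.
  rewrite ler_wpM2l ?mulr_ge0 ?exprn_ge0 // ler_wpM2l ?exprn_ge0 //.
  by rewrite lerXn2r ?nnegrE.
have a0 : 0 <= 1 + g by lra.
have b0 : 0 <= 1 - g by lra.
have C0 : 0 <= ((1 - g ^+ 2) ^+ H)^-1 by rewrite invr_ge0 exprn_ge0 // ltW.
have sz : (2 * H + 0 + 0 = 2 * H)%N by lia.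
split=> hp.
- apply: le_trans (key (1 + g) (1 - g) a0 b0 _ _); [|by ring|by nra].
  apply: (votes_potential p01 a0 b0 C0 _ sz) => s t st; case: leqP => Hs; last first.
    by rewrite mulr0n !mulr_ge0 ?exprn_ge0.
  by rewrite mulr1n; apply: pw => //; [lra|ring].
- rewrite -votes_compl; apply: le_trans (key (1 - g) (1 + g) b0 a0 _ _); [|by ring|by nra].
  apply: (votes_potential p01 b0 a0 C0 _ sz) => s t st; case: leqP => Hs.
    by rewrite mulr1n subrr !mulr_ge0 ?exprn_ge0.
  by rewrite mulr0n subr0 mulrAC; apply: pw => //; [lra|ring|lia|lia].
Qed.

End Votes.

(** * Error propagation through a line search *)

Section Expectation.
Context {R : realType} {n : nat}.
Local Notation vec := 'rV[R]_n.
Variables (q : vec -> vec -> R) (s0 : R).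
Hypothesis q01 : forall x y, 0 <= q x y <= 1.
Hypothesis n0 : (0 < n)%N.

Lemma mean_const (c : R) : n%:R^-1 * \sum_(j < n) c = c.
Proof.
by rewrite sumr_const card_ord -[c *+ n]mulr_natl mulrA mulVf ?mul1r // pnatr_eq0; lia.
Qed.

Lemma mean_le (F G : 'I_n -> R) : (forall j, F j <= G j) ->
  n%:R^-1 * \sum_(j < n) F j <= n%:R^-1 * \sum_(j < n) G j.
Proof. by move=> FG; rewrite ler_wpM2l ?invr_ge0 ?ler0n // ler_sum. Qed.

Lemma tour_le H x e K B cs t : (forall t, K t <= B) -> tour q H x e K cs t <= B.
Proof.
move=> KB; elim: cs t => [|c cs IH] t //=.
by apply: votes_le => // s; case: leqP.
Qed.

Lemma tour_compl H x e K cs t :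
  tour q H x e (fun t => 1 - K t) cs t = 1 - tour q H x e K cs t.
Proof.
elim: cs t => [|c cs IH] t //=; rewrite -votes_compl; congr (votes _ _ _ _).
by apply/funext => s; case: leqP.
Qed.

Lemma sched_exp_le P B sched x : (forall y, P y <= B) -> sched_exp q s0 P sched x <= B.
Proof.
move=> PB; elim: sched x => [|[J H] sched IH] x //=.
rewrite -[B]mean_const; apply: mean_le => j; exact: tour_le.
Qed.

Lemma sched_exp_compl P sched x :
  sched_exp q s0 (fun y => 1 - P y) sched x = 1 - sched_exp q s0 P sched x.
Proof.
elim: sched x => [|[J H] sched IH] x //=.
rewrite -[X in X - _](mean_const 1) -mulrBr -sumrB; congr (_ * _); apply: eq_bigr => j _.
by rewrite -tour_compl; congr (tour _ _ _ _ _ _ _); apply/funext => t.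
Qed.

Lemma sched_exp_cat P s1 s2 x :
  sched_exp q s0 P (s1 ++ s2) x = sched_exp q s0 (sched_exp q s0 P s2) s1 x.
Proof.
elim: s1 x => [|[J H] s1 IH] x //=; congr (_ * _); apply: eq_bigr => j _.
by congr (tour _ _ _ _ _ _ _); apply/funext => t.
Qed.

Variable f : vec -> R.

(** [D] is the resolution: no reliability is asked for values within [D], where the wrong choice
    costs at most [D]. *)
Definition accurate (H : nat) (D eps : R) : Prop := forall x y,
  (f x + D < f y -> votes (q x y) (fun s => (H <= s)%N%:R) (2 * H) 0 <= eps) /\
  (f y + D < f x -> 1 - votes (q x y) (fun s => (H <= s)%N%:R) (2 * H) 0 <= eps).

(** Union bound: outside an event of probability [eps], a comparison keeps a point at most [D] above
    both competitors. Since [K] is at most 1, a failed comparison adds at most [eps] to the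
    expectation. *)
Lemma tour_bound H D eps x e K B cs best : accurate H D eps -> 0 <= D -> 0 <= eps -> 0 <= B ->
  (forall t, K t <= 1) ->
  (forall t, f (x + t *: e) <= f (x + best *: e) + (size cs)%:R * D ->
     (forall c, c \in cs -> f (x + t *: e) <= f (x + c *: e) + (size cs)%:R * D) -> K t <= B) ->
  tour q H x e K cs best <= B + (size cs)%:R * eps.
Proof.
move=> acc D0 e0 B0 K1; elim: cs best => [|c cs IH] best KB /=.
  by rewrite mul0r addr0; apply: KB => //; rewrite mul0r addr0.
have IHb b : f (x + b *: e) <= f (x + best *: e) + D -> f (x + b *: e) <= f (x + c *: e) + D ->
    tour q H x e K cs b <= B + (size cs)%:R * eps.
  move=> hb hc; apply: IH => t ht hcs; apply: KB.
    by rewrite /= -natr1 mulrDl mul1r; lra.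
  move=> c'; rewrite inE /= -natr1 mulrDl mul1r => /orP[/eqP -> | /hcs]; lra.
have T1 b : tour q H x e K cs b <= 1 by apply: tour_le.
rewrite votes_if -natr1 [(_ + 1) * eps]mulrDl mul1r.
set w := votes _ _ _ _; have w01 : 0 <= w <= 1.
  by rewrite votes_ge0 //= votes_le // => s; case: leqP.
have [h1 h2] := acc (x + best *: e) (x + c *: e).
set N := (size cs)%:R * eps in IHb *.
have N0 : 0 <= N by rewrite mulr_ge0.
have BN : 0 <= B + N by lra.
have mix w' u v : 0 <= w' <= 1 -> w' <= eps -> u <= 1 -> v <= B + N ->
    w' * u + (1 - w') * v <= B + (N + eps).
  move=> /andP[w0 w1] we u1 vB; have w1' : 0 <= 1 - w' by lra.
  have := ler_wpM2l w0 u1; have := ler_wpM2l w1' vB; have := mulr_ge0 w0 BN; lra.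
have [lt1|ge1] := ltP (f (x + best *: e) + D) (f (x + c *: e)).
  by apply: mix => //; [exact: h1|apply: IHb; lra].
have [lt2|ge2] := ltP (f (x + c *: e) + D) (f (x + best *: e)).
  rewrite -[w in w * _](subKr 1) addrC; apply: mix => //; [by lra|exact: h2|apply: IHb; lra].
(* The two values are within [D] of each other, so either winner is acceptable, whatever [w] is. *)
have /andP[w0 w1] := w01; have w1' : 0 <= 1 - w by lra.
have Ib : tour q H x e K cs best <= B + N by apply: IHb; lra.
have Ic : tour q H x e K cs c <= B + N by apply: IHb; lra.
by have := ler_wpM2l w0 Ic; have := ler_wpM2l w1' Ib; lra.
Qed.

End Expectation.

(** * Gradient inequalities and the gain of one grid step *)

Section StronglyConvex.
Context {R : realType} {n : nat}.
Local Notation vec := 'rV[R]_n.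
Implicit Types x y u v : vec.

Lemma dotv_ge0 u : 0 <= dotv u u.
Proof. by apply: sumr_ge0 => i _; rewrite -expr2 sqr_ge0. Qed.

Lemma enorm_sq u : enorm u ^+ 2 = dotv u u.
Proof. by rewrite sqr_sqrtr // dotv_ge0. Qed.

Lemma dotv_evec u (t : R) i : dotv u (t *: evec i) = t * u 0 i.
Proof.
rewrite /dotv (bigD1 i) //= big1 => [|j ji]; rewrite !mxE !eqxx /=.
  by rewrite addr0 mulr1 mulrC.
by rewrite (negbTE ji) /= !mulr0.
Qed.

Lemma dotv_sq_lin (a : R) u v :
  dotv (u + a *: v) (u + a *: v) = dotv u u + 2 * a * dotv u v + a ^+ 2 * dotv v v.
Proof.
rewrite /dotv !mulr_sumr -!big_split /=; apply: eq_bigr => i _.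
by rewrite !mxE; ring.
Qed.

Lemma dotvC u v : dotv u v = dotv v u.
Proof. by apply: eq_bigr => i _; rewrite mulrC. Qed.

Lemma dotvDl u v w : dotv (u + v) w = dotv u w + dotv v w.
Proof. by rewrite /dotv -big_split /=; apply: eq_bigr => i _; rewrite mxE mulrDl. Qed.

Lemma dotvZr (a : R) u v : dotv u (a *: v) = a * dotv u v.
Proof. by rewrite /dotv mulr_sumr; apply: eq_bigr => i _; rewrite mxE mulrCA. Qed.

Lemma dotvNr u v : dotv u (- v) = - dotv u v.
Proof. by rewrite -scaleN1r dotvZr mulN1r. Qed.

Lemma dotvNN u : dotv (- u) (- u) = dotv u u.
Proof. by rewrite dotvNr dotvC dotvNr opprK. Qed.

Variables (tau L : R) (f : vec -> R) (g : vec -> vec) (xs : vec).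
Hypothesis tau0 : 0 < tau.
Hypothesis tauL : tau <= L.
Hypothesis convf : forall x y, f x + dotv (g x) (y - x) + tau / 2 * enorm (x - y) ^+ 2 <= f y.
Hypothesis lipf : forall x y, enorm (g x - g y) <= L * enorm (x - y).
Hypothesis xsmin : is_minimizer f xs.

Let L0 : 0 < L. Proof. exact: lt_le_trans tauL. Qed.

(** Convexity at [y] reduces the claim to comparing [g x] with [g y]; the Lipschitz bound enters
    through the nonnegative square of [(g x - g y) + L *: (y - x)]. This avoids integrating the
    gradient and gives the constant [L] instead of [L / 2]. *)
Lemma smooth_le x y : f y <= f x + dotv (g x) (y - x) + L * dotv (y - x) (y - x).
Proof.
have := convf y x; rewrite enorm_sq -opprB dotvNr.
have : 0 <= tau / 2 * dotv (y - x) (y - x).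
  by rewrite mulr_ge0 ?dotv_ge0 // divr_ge0 // ltW.
set w := y - x => h1 h2.
have -> : g x = g y + (g x - g y) by rewrite addrC subrK.
rewrite dotvDl; have := dotv_ge0 ((g x - g y) + L *: w); rewrite dotv_sq_lin.
have : dotv (g x - g y) (g x - g y) <= L ^+ 2 * dotv w w.
  rewrite -!enorm_sq -exprMn lerXn2r ?nnegrE ?sqrtr_ge0 ?mulr_ge0 ?sqrtr_ge0 ?(ltW L0) //.
  by rewrite (le_trans (lipf _ _)) // -(opprB y x) /enorm dotvNN.
move=> h3 h4; set D := dotv (g x - g y) w in h4 *; set W := dotv w w in h1 h2 h3 h4 *.
have : 0 <= 2 * L * (D + L * W) by lra.
by rewrite pmulr_rge0 ?mulr_gt0 //; lra.
Qed.

Lemma smooth_coord x t j : f (x + t *: evec j) <= f x + t * g x 0 j + L * t ^+ 2.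
Proof.
apply: le_trans (smooth_le x _) _; rewrite [x + _]addrC addrK !dotv_evec !mxE !eqxx /=.
by rewrite mulr1 expr2.
Qed.

(** A gradient step of length [1 / (2 * L)] lowers [f] by at least [dotv (g x) (g x) / (4 * L)], and
    cannot go below the minimum. *)
Lemma grad_sq_le x : dotv (g x) (g x) <= 4 * L * (f x - f xs).
Proof.
have := smooth_le x (x + (- (2 * L)^-1) *: g x); rewrite [x + _]addrC addrK !dotvZr [dotv (_ *: _) _]dotvC dotvZr.
have := xsmin ((- (2 * L)^-1) *: g x + x).
set G := dotv (g x) (g x) => h1 h2.
have : f xs <= f x - G / (4 * L).
  by apply: le_trans h1 (le_trans h2 _); apply: le_of_eq; field; rewrite gt_eqF.
have L4 : 0 < 4 * L by rewrite mulr_gt0.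
by rewrite [4 * L * _]mulrC -ler_pdivrMr //; lra.
Qed.

Lemma grad_coord_sq_le x j : g x 0 j ^+ 2 <= 4 * L * (f x - f xs).
Proof.
apply: le_trans (grad_sq_le x); rewrite /dotv (bigD1 j) //= -expr2 lerDl.
by apply: sumr_ge0 => i _; rewrite -expr2 sqr_ge0.
Qed.

(** Polyak-Lojasiewicz inequality: strong convexity from [x] to [xs], completed to the square of
    [g x + tau *: (xs - x)]. *)
Lemma grad_sq_ge x : 2 * tau * (f x - f xs) <= \sum_(j < n) g x 0 j ^+ 2.
Proof.
have -> : \sum_(j < n) g x 0 j ^+ 2 = dotv (g x) (g x) by [].
have := convf x xs; rewrite enorm_sq -(opprB xs x) dotvNN.
have := dotv_ge0 (g x + tau *: (xs - x)); rewrite dotv_sq_lin => h1 h2.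
have t2 : 0 <= 2 * tau by rewrite mulr_ge0 // ltW.
by have := ler_wpM2l t2 h2; lra.
Qed.

(** The gradient vanishes at [xs], so only the quadratic term of [smooth_le] remains. *)
Lemma initial_gap x : f x - f xs <= L * enorm (xs - x) ^+ 2.
Proof.
have G0 : dotv (g xs) (g xs) <= 0 by apply: le_trans (grad_sq_le xs) _; rewrite subrr mulr0.
have gz : dotv (g xs) (x - xs) = 0.
  have e0 i : g xs 0 i = 0.
    apply/eqP; rewrite -sqrf_eq0 eq_le sqr_ge0 andbT.
    by have := grad_coord_sq_le xs i; rewrite subrr mulr0.
  by rewrite /dotv big1 // => i _; rewrite e0 mul0r.
by have := smooth_le xs x; rewrite gz enorm_sq -(opprB x) dotvNN; lra.
Qed.

Lemma grid_cover (s0 a : R) J : 0 <= a -> a <= s0 ->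
  a <= s0 / 2 ^+ J \/ exists2 j, (j < J)%N & s0 / 2 ^+ j.+1 <= a <= 2 * (s0 / 2 ^+ j.+1).
Proof.
move=> a0 as0; elim: J => [|J [IH|[j jJ hj]]]; first by left; rewrite expr0 divr1.
- have [le|gt] := leP a (s0 / 2 ^+ J.+1); first by left.
  right; exists J => //; rewrite (ltW gt) /=; apply: le_trans IH _; apply: le_of_eq.
  by rewrite exprS; field; rewrite ?expf_neq0.
- by right; exists j => //; apply: leq_trans jJ _.
Qed.

(** With [d = g x 0 j], the length [a = |d| / (2 * L)] minimises the quadratic upper bound along the
    coordinate, and the hypothesis on the gap ensures [a <= s0]. Either [a] is below the finest
    scale and the gain at stake is negligible, or a grid point within a factor two of [a] retains
    half of [d ^+ 2 / (4 * L)]. *)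
Lemma grid_progress (s0 : R) J x j : 0 <= s0 -> f x - f xs <= L * s0 ^+ 2 ->
  g x 0 j ^+ 2 / (8 * L) <= L * s0 ^+ 2 / (2 * 4 ^+ J) \/
  exists2 c, c \in grid s0 J & f (x + c *: evec j) <= f x - g x 0 j ^+ 2 / (8 * L).
Proof.
move=> s00 err; set d := g x 0 j; pose a := `|d| / (2 * L).
have a0 : 0 <= a by rewrite divr_ge0 // mulr_ge0 // ltW.
have dE : d ^+ 2 = 4 * L ^+ 2 * a ^+ 2.
  by rewrite /a expr_div_n real_normK ?num_real //; field; rewrite gt_eqF.
have dd : d ^+ 2 / (8 * L) = L * a ^+ 2 / 2 by rewrite dE; field; rewrite gt_eqF.
have as0 : a <= s0.
  rewrite -(@ler_pXn2r _ 2) ?nnegrE //.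
  have := grad_coord_sq_le x j; rewrite -/d dE => h.
  have L4 : 0 < 4 * L ^+ 2 by rewrite mulr_gt0 ?exprn_gt0.
  rewrite -(ler_pM2l L4); apply: le_trans h _.
  by rewrite expr2 -!mulrA ler_wpM2l // ler_wpM2l ?(ltW L0).
rewrite dd; have [le|[k kJ /andP[h1 h2]]] := grid_cover J a0 as0.
  left; have -> : L * s0 ^+ 2 / (2 * 4 ^+ J) = L * (s0 / 2 ^+ J) ^+ 2 / 2.
    rewrite expr_div_n -exprM mulnC exprM; have -> : 2 ^+ 2 = 4 :> R by ring.
    by field; rewrite expf_neq0.
  by rewrite ler_pM2r // ler_pM2l // lerXn2r ?nnegrE // (le_trans a0).
right; set t := s0 / 2 ^+ k.+1 in h1 h2.
have tb : L * t ^+ 2 - 2 * L * a * t <= - (L * a ^+ 2 / 2).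
  have : 0 <= L * ((2 * t - a) * (3 * a - 2 * t)).
    by rewrite mulr_ge0 ?mulr_ge0 ?(ltW L0) //; lra.
  by have := mulr_ge0 (ltW L0) (sqr_ge0 a); lra.
have da : `|d| = 2 * L * a by rewrite /a; field; rewrite gt_eqF.
have kin : k \in iota 0 J by rewrite mem_iota.
have [d0|d0] := leP 0 d.
  exists (- t); first by rewrite mem_cat; apply/orP; right; apply: (map_f (fun j => - (s0 / 2 ^+ j.+1))).
  by apply: le_trans (smooth_coord x _ j) _; rewrite -/d sqrrN; move: da; rewrite ger0_norm // => ->; lra.
exists t; first by rewrite mem_cat; apply/orP; left; apply: (map_f (fun j => s0 / 2 ^+ j.+1)).
apply: le_trans (smooth_coord x _ j) _; rewrite -/d; move: da; rewrite ltr0_norm // => da.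
have -> : d = - (2 * L * a) by rewrite -da opprK.
by lra.
Qed.

End StronglyConvex.

(** A potential truncated at 0 can use at most its current value [Z] of the decrease in a
    coordinate; capping the terms loses no more than capping the sum. *)
Lemma min_sum_le {R : realType} (I : finType) (Z : R) (d : I -> R) : 0 <= Z ->
  (forall i, 0 <= d i) -> Num.min Z (\sum_i d i) <= \sum_i Num.min Z (d i).
Proof.
move=> Z0 d0; suff : [/\ Num.min Z (\sum_i d i) <= \sum_i Num.min Z (d i),
  0 <= \sum_i d i & 0 <= \sum_i Num.min Z (d i)] by case.
elim/big_rec2: _ => [|i S M _ [h1 h2 h3]]; first by rewrite ge_min !lexx orbT.
have di := d0 i; split; [|by lra|by rewrite addr_ge0 // le_min Z0 di].
by move: h1; case: (leP Z M); case: (leP Z (d i)); case: (leP Z S); case: (leP Z (d i + M)); lra.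
Qed.

(** * One phase: bounded harm and contraction of the gap *)

Section Phases.
Context {R : realType} {n : nat}.
Local Notation vec := 'rV[R]_n.
Variables (tau L : R) (f : vec -> R) (g : vec -> vec) (xs : vec).
Hypothesis tau0 : 0 < tau.
Hypothesis tauL : tau <= L.
Hypothesis convf : forall x y, f x + dotv (g x) (y - x) + tau / 2 * enorm (x - y) ^+ 2 <= f y.
Hypothesis lipf : forall x y, enorm (g x - g y) <= L * enorm (x - y).
Hypothesis xsmin : is_minimizer f xs.
Variables (q : vec -> vec -> R) (s0 : R).
Hypothesis q01 : forall x y, 0 <= q x y <= 1.
Hypothesis n0 : (0 < n)%N.
Variables (J H : nat) (D eps : R).
Hypothesis acc : accurate q f H D eps.
Hypothesis D0 : 0 <= D.
Hypothesis eps0 : 0 <= eps.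

Let L0 : 0 < L. Proof. exact: lt_le_trans tauL. Qed.
Local Notation m := (2 * J)%N.
Local Notation err x := (f x - f xs).

Lemma no_harm K x k e0 B : (forall y, k y <= 1) -> 0 <= B ->
  (forall y, err y <= e0 + (K * m)%:R * D -> k y <= B) -> err x <= e0 ->
  sched_exp q s0 k (nseq K (J, H)) x <= B + (K * m)%:R * eps.
Proof.
move=> k1 B0; elim: K x e0 => [|K IH] x e0 kB ex /=.
  by rewrite mul0n mul0r addr0; apply: kB; rewrite mul0n mul0r addr0.
rewrite -[X in _ <= X](mean_const n0); apply: mean_le => j.
have N0 : 0 <= (K * m)%:R * eps by rewrite mulr_ge0.
have sg : m%:R * eps = (size (grid s0 J))%:R * eps by rewrite size_grid.
rewrite mulSn addnC natrD mulrDl addrA sg.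
apply: (tour_bound q01 acc) => //; first by lra.
  by move=> t; apply: sched_exp_le.
move=> t; rewrite scale0r addr0 size_grid => ht _.
apply: (IH _ (e0 + m%:R * D)); last by lra.
move=> y hy; apply: kB; apply: le_trans hy _.
by rewrite mulSn natrD mulrDl; lra.
Qed.

(** [zeta] bounds the gain missed when the ideal step is below the finest scale, [eta] the whole
    loss of one iteration; [c / n%:R] is the contraction rate. *)
Let zeta := L * s0 ^+ 2 / (2 * 4 ^+ J).
Let eta := m%:R * D + zeta.
Let c := tau / (4 * L).

(* The losses [eta] still to come are credited in advance, so that the potential
   [max 0 (err + K eta - a)] never increases and its mean contracts; a bound on the
   mean of [err] itself would cost a factor [1 / delta] on the noise level. *)
Lemma descent K x k theta a beta : (forall y, k y <= 1) -> 0 <= s0 -> 0 < theta -> 0 <= beta ->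
  (forall y, k y <= Num.max 0 (err y - a) / theta + beta) ->
  K%:R * eta <= a -> err x + (K * m)%:R * D <= L * s0 ^+ 2 ->
  sched_exp q s0 k (nseq K (J, H)) x <=
  (1 - c / n%:R) ^+ K * Num.max 0 (err x + K%:R * eta - a) / theta + beta + (K * m)%:R * eps.
Proof.
move=> k1 s00 th0 b0 kB; elim: K x => [|K IH] x Ka eM /=.
  by rewrite expr0 mul1r !mul0r !addr0; apply: kB.
have N0 : 0 <= (K * m)%:R * eps by rewrite mulr_ge0.
have mD0 : 0 <= m%:R * D by rewrite mulr_ge0.
have KmD0 : 0 <= (K * m)%:R * D by rewrite mulr_ge0.
have zeta0 : 0 <= zeta by rewrite divr_ge0 ?mulr_ge0 ?exprn_ge0 ?(ltW L0).
have eta0 : 0 <= eta by rewrite addr_ge0.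
have ex0 : 0 <= err x by rewrite subr_ge0.
have c0 : 0 < c by rewrite divr_gt0 ?mulr_gt0.
have c1 : c <= 1 by rewrite ler_pdivrMr ?mulr_gt0 //; move: L0 tauL; lra.
have nR : 1 <= n%:R :> R by rewrite ler1n.
have rho0 : 0 <= 1 - c / n%:R by rewrite subr_ge0 ler_pdivrMr; lra.
have eML : err x <= L * s0 ^+ 2 by move: eM; rewrite mulSn natrD mulrDl; lra.
have Ka' : K%:R * eta <= a by move: Ka; rewrite -natr1 mulrDl; lra.
pose Z := Num.max 0 (err x + K.+1%:R * eta - a).
have Z0 : 0 <= Z by rewrite le_max lexx.
(* The credit [K.+1%:R * eta] does not exceed [a], so strong convexity, which bounds the gains below
   through [err x], also bounds them through [Z]. *)
have Ze : Z <= err x by rewrite ge_max ex0 /=; lra.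
pose d j := g x 0 j ^+ 2 / (8 * L).
have d0 j : 0 <= d j by rewrite divr_ge0 ?sqr_ge0 ?mulr_ge0 ?(ltW L0).
have sd : c * Z <= \sum_j Num.min Z (d j).
  apply: le_trans (min_sum_le Z0 d0); rewrite le_min ler_piMl //=.
  apply: le_trans (_ : c * err x <= _); first by rewrite ler_pM2l.
  rewrite -mulr_suml ler_pdivlMr ?mulr_gt0 //; apply: le_trans (grad_sq_ge xs tau0 convf x).
  by apply: le_of_eq; rewrite /c; field; rewrite gt_eqF.
pose B j := (1 - c / n%:R) ^+ K * (Z - Num.min Z (d j)) / theta + beta + (K * m)%:R * eps.
apply: (@le_trans _ _ (n%:R^-1 * \sum_(j < n) (B j + m%:R * eps))).
  have sg : m%:R * eps = (size (grid s0 J))%:R * eps by rewrite size_grid.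
  apply: mean_le => j; rewrite sg.
  apply: (tour_bound q01 acc) => //.
  - rewrite addr_ge0 // addr_ge0 // divr_ge0 ?(ltW th0) // mulr_ge0 ?exprn_ge0 //.
    by rewrite subr_ge0 ge_min lexx.
  - by move=> t; apply: sched_exp_le.
  move=> t; rewrite scale0r addr0 size_grid => ht hc; set y := x + t *: evec j in ht hc *.
  have hy : err y <= err x - d j + eta.
    have [le|[c' c'in hc']] := grid_progress tau0 tauL convf lipf xsmin J j s00 eML.
      by rewrite /eta /zeta /d; lra.
    by have := hc _ c'in; rewrite /eta /d; lra.
  apply: le_trans (IH y Ka' _) _; first by move: eM; rewrite mulSn natrD mulrDl; lra.
  rewrite !lerD2r ler_pM2r ?invr_gt0 // ler_wpM2l ?exprn_ge0 //.
  rewrite ge_max subr_ge0 ge_min lexx /=.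
  have Zge : err x + (K%:R + 1) * eta - a <= Z by rewrite natr1 le_max lexx orbT.
  have mge : Num.min Z (d j) <= d j by rewrite ge_min lexx orbT.
  by lra.
have E : n%:R^-1 * \sum_(j < n) (B j + m%:R * eps) =
  (1 - c / n%:R) ^+ K * (Z - n%:R^-1 * \sum_j Num.min Z (d j)) / theta + beta + (K.+1 * m)%:R * eps.
  have -> : Z - n%:R^-1 * \sum_j Num.min Z (d j) = n%:R^-1 * \sum_j (Z - Num.min Z (d j)).
    by rewrite sumrB mulrBr mean_const.
  rewrite big_split /= mulrDr mean_const // /B big_split /= mulrDr mean_const //.
  rewrite big_split /= mulrDr mean_const // -mulr_suml -mulr_sumr mulSn addnC natrD.
  by ring.
(* By [sd] the mean capped decrease is at least [c * Z / n%:R], which is one more contraction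
   factor. *)
rewrite E !lerD2r ler_pM2r ?invr_gt0 // exprSr -mulrA ler_wpM2l ?exprn_ge0 // -/Z.
rewrite mulrBl mul1r lerD2l lerN2 mulrAC [c * Z / _]mulrC ler_wpM2l ?invr_ge0 //.
Qed.

End Phases.

(** * Failure probability of the two-phase schedule *)

Section TwoPhases.
Context {R : realType} {n : nat}.
Local Notation vec := 'rV[R]_n.

(** [g] is the bias of a single vote beyond the resolution; the majority bound is at most
    [expR (- (3 * g ^+ 2 * H%:R))]. *)
Lemma oracle_accurate (kappa mu delta0 : R) (f : vec -> R) q (D g l : R) H :
  comparison_oracle kappa mu delta0 f q -> 0 <= D -> 0 <= g <= 1 / 2 ->
  (forall z, D < z -> g <= Num.min delta0 (mu * z `^ (kappa - 1))) ->
  2 * l <= 3 * g ^+ 2 * H%:R -> accurate q f H D (expR (- (2 * l))).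
Proof.
move=> [q01 qacc] D0 g01 gD lH.
have E : (1 - g ^+ 2) ^+ (3 * H) <= expR (- (2 * l)).
  have g2 : 0 <= 1 - g ^+ 2 by nra.
  apply: (@le_trans _ _ (expR (- g ^+ 2) ^+ (3 * H))).
    by rewrite lerXn2r ?nnegrE ?expR_ge0 // expR_ge1Dx.
  by rewrite -expRM_natl ler_expR natrM; lra.
move=> x y; have [h1 h2] := votes_majority H (q01 x y) g01; split=> lt.
- apply: le_trans (h1 _) E; have ne : f x != f y by rewrite lt_eqF //; lra.
  have := qacc _ _ ne; have -> : f x < f y by lra.
  have gz : g <= Num.min delta0 (mu * `|f y - f x| `^ (kappa - 1)).
    by apply: gD; rewrite ger0_norm; lra.
  by lra.
- apply: le_trans (h2 _) E; have ne : f x != f y by rewrite gt_eqF //; lra.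
  have := qacc _ _ ne; have -> : (f x < f y) = false by apply/negbTE; rewrite -leNgt; lra.
  have gz : g <= Num.min delta0 (mu * `|f y - f x| `^ (kappa - 1)).
    by apply: gD; rewrite ltr0_norm; lra.
  by lra.
Qed.

Lemma one_sub_pow_le (c : R) N : (0 < n)%N -> 0 <= c <= 1 ->
  0 <= (1 - c / n%:R) ^+ (n * N) <= expR (- (c * N%:R)).
Proof.
move=> n0 /andP[c0 c1]; have nR : 1 <= n%:R :> R by rewrite ler1n.
have r0 : 0 <= 1 - c / n%:R by rewrite subr_ge0 ler_pdivrMr; lra.
rewrite exprn_ge0 //=; apply: (@le_trans _ _ (expR (- (c / n%:R)) ^+ (n * N))).
  by rewrite lerXn2r ?nnegrE ?expR_ge0 // expR_ge1Dx.
rewrite -expRM_natl ler_expR natrM; apply: le_of_eq; field.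
by rewrite gt_eqF //; lra.
Qed.

Variables (tau L : R) (f : vec -> R) (g : vec -> vec) (xs : vec).
Hypothesis tau0 : 0 < tau.
Hypothesis tauL : tau <= L.
Hypothesis convf : forall x y, f x + dotv (g x) (y - x) + tau / 2 * enorm (x - y) ^+ 2 <= f y.
Hypothesis lipf : forall x y, enorm (g x - g y) <= L * enorm (x - y).
Hypothesis xsmin : is_minimizer f xs.
Variables (q : vec -> vec -> R) (s0 : R).
Hypothesis q01 : forall x y, 0 <= q x y <= 1.
Hypothesis n0 : (0 < n)%N.
Variables (N1 J1 H1 N2 J2 H2 : nat) (eps e0 r theta : R).
Hypothesis eps0 : 0 <= eps.
Hypothesis s00 : 0 <= s0.
Hypothesis th0 : 0 < theta.

Local Notation err x := (f x - f xs).
Local Notation K1 := (n * N1)%N.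
Local Notation K2 := (n * N2)%N.
Local Notation bad := (fun x => (r < err x)%R%:R : R).
Local Notation sched := (nseq K1 (J1, H1) ++ nseq K2 (J2, H2)).
Local Notation c := (tau / (4 * L)).

Let L0 : 0 < L. Proof. exact: lt_le_trans tauL. Qed.

Let c01 : 0 <= c <= 1.
Proof.
rewrite divr_ge0 ?mulr_ge0 ?(ltW tau0) ?(ltW L0) //= ler_pdivrMr ?mulr_gt0 //.
by move: L0 tauL; lra.
Qed.

Let bad_le1 y : bad y <= 1. Proof. by rewrite lern1 leq_b1. Qed.

(** Pointwise form of Markov's inequality. *)
Lemma bad_potential a y : a + theta <= r -> bad y <= Num.max 0 (err y - a) / theta.
Proof.
move=> ar /=; case: ltP => h /=; last by rewrite mulr0n divr_ge0 ?(ltW th0) // le_max lexx.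
by rewrite mulr1n ler_pdivlMr // mul1r le_max; apply/orP; right; lra.
Qed.

(** For [kappa = 1]: the first phase contracts, and the second, also of resolution 0, adds only its
    own error probability [b]. *)
Lemma bad_prob_phase1 x : accurate q f H1 0 eps -> accurate q f H2 0 eps ->
  err x <= e0 -> e0 <= L * s0 ^+ 2 ->
  K1%:R * (L * s0 ^+ 2 / (2 * 4 ^+ J1)) + theta <= r ->
  sched_exp q s0 bad sched x <=
  expR (- (c * N1%:R)) * e0 / theta + (K1 * (2 * J1) + K2 * (2 * J2))%:R * eps.
Proof.
move=> acc1 acc2 xe eL hr; rewrite sched_exp_cat.
set k := sched_exp q s0 bad _; set b := (K2 * (2 * J2))%:R * eps.
have b0 : 0 <= b by rewrite mulr_ge0.
set a := K1%:R * _ in hr.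
have kb y : k y <= Num.max 0 (err y - a) / theta + b.
  apply: le_trans (_ : bad y + b <= _); last by rewrite lerD2r bad_potential.
  rewrite /=; have [le|lt] /= := leP (err y) r.
    rewrite mulr0n add0r; rewrite -[b]add0r.
    apply: (no_harm s0 q01 n0 acc2 (lexx 0) eps0 bad_le1 (lexx 0) _ le) => z.
    by rewrite mulr0 addr0 leNgt => /negbTE ->.
  rewrite mulr1n; apply: (@le_trans _ _ 1); last by lra.
  exact: sched_exp_le.
have k1 y : k y <= 1 by exact: sched_exp_le.
apply: le_trans (descent tau0 tauL convf lipf xsmin q01 n0 acc1 (lexx 0) eps0 k1 s00 th0 b0 kb _ _) _.
- by rewrite mulr0 add0r.
- by rewrite mulr0 addr0 (le_trans xe).
rewrite mulr0 add0r.
rewrite -/a addrK natrD [(_ + _) * eps]mulrDl -/b -[X in X <= _]addrA [b + _]addrC lerD2r.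
rewrite ler_pM2r ?invr_gt0 //; have /andP[p0 p1] := one_sub_pow_le N1 n0 c01.
have ex0 : 0 <= err x by rewrite subr_ge0.
by apply: ler_pM; rewrite // ?le_max ?lexx // ge_max (le_trans ex0).
Qed.

(** For [kappa > 1]: the first phase, of resolution 1, adds at most its number of comparisons to the
    gap, and the second contracts the gap it receives, at most [e0]. *)
Lemma bad_prob_phase2 x D : accurate q f H1 1 eps -> accurate q f H2 D eps -> 0 <= D ->
  err x + (K1 * (2 * J1))%:R <= e0 -> e0 + (K2 * (2 * J2))%:R * D <= L * s0 ^+ 2 ->
  K2%:R * ((2 * J2)%:R * D + L * s0 ^+ 2 / (2 * 4 ^+ J2)) + theta <= r ->
  sched_exp q s0 bad sched x <=
  expR (- (c * N2%:R)) * e0 / theta + (K1 * (2 * J1) + K2 * (2 * J2))%:R * eps.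
Proof.
move=> acc1 acc2 D0 xe eL hr; rewrite sched_exp_cat.
set k := sched_exp q s0 bad _; set b := (K2 * (2 * J2))%:R * eps.
have b0 : 0 <= b by rewrite mulr_ge0.
set a := K2%:R * _ in hr.
have ex0 : 0 <= err x by rewrite subr_ge0.
have e00 : 0 <= e0 by apply: le_trans xe; rewrite addr_ge0.
have /andP[p0 p1] := one_sub_pow_le N2 n0 c01.
have k1 y : k y <= 1 by exact: sched_exp_le.
rewrite natrD [(_ + _) * eps]mulrDl [_ + b]addrC [X in _ <= X]addrA; apply: (no_harm s0 q01 n0 acc1 ler01 eps0 k1 _ _ (lexx (err x))).
  by rewrite addr_ge0 // mulr_ge0 ?invr_ge0 ?(ltW th0) // mulr_ge0 ?expR_ge0.
move=> y; rewrite mulr1 => hy.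
have bp z : bad z <= Num.max 0 (err z - a) / theta + 0 by rewrite addr0 bad_potential.
apply: le_trans (descent tau0 tauL convf lipf xsmin q01 n0 acc2 D0 eps0 bad_le1 s00 th0 (lexx 0) bp _ _) _.
- by [].
- by apply: le_trans eL; rewrite lerD2r (le_trans hy).
rewrite -/a addrK addr0 -/b lerD2r ler_pM2r ?invr_gt0 //.
have ey : err y <= e0 by apply: le_trans xe.
by apply: ler_pM; rewrite // ?le_max ?lexx // ge_max e00.
Qed.

End TwoPhases.

(** Each phase gets at most half of the queries. The first makes [N] iterations per coordinate on a
    grid of depth [N], about [C * l * n * N ^ 2] queries, so [N] is of order [S / l]: hence the
    square root in the exponential rate. The second needs only [l ^ 2] iterations per coordinate at
    depth [l ^ 2], which leaves [H] of order [T / (n * l ^ 4)]. *)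
Lemma schedule_arith (n C C0 l S T : nat) : (0 < n)%N -> (0 < C)%N -> (0 < l)%N ->
  (S ^ 2 * n <= T)%N -> (8 * C <= C0)%N -> (C0 * l ^ 3 <= S)%N ->
  let N := (S %/ (8 * C * l))%N in let H := (T %/ (8 * n * l ^ 4))%N in
  [/\ (0 < N)%N, (C * l <= H)%N, (S <= 16 * C * l * N)%N, (T <= 16 * n * l ^ 4 * H)%N &
      (n * N * (2 * N * (2 * (C * l))) + n * l ^ 2 * (2 * l ^ 2 * (2 * H)) <= T)%N].
Proof.
move=> n0 C0' l0 ST CC lS N H.
have CC0 : (0 < C0)%N by apply: leq_trans CC; rewrite muln_gt0.
have l20 : (0 < l ^ 2)%N by rewrite expn_gt0 l0.
have l40 : (0 < l ^ 4)%N by rewrite expn_gt0 l0.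
have d10 : (0 < 8 * C * l)%N by rewrite !muln_gt0 C0' l0.
have d20 : (0 < 8 * n * l ^ 4)%N by rewrite muln_gt0 muln_gt0 n0 l40.
have CS : (8 * C * l <= S)%N.
  apply: leq_trans lS; rewrite expnS; nia.
have N0 : (0 < N)%N by rewrite divn_gt0.
have CT : (C * l * (8 * n * l ^ 4) <= T)%N.
  apply: leq_trans ST; apply: (@leq_trans ((C0 * l ^ 3) ^ 2 * n)%N); last by rewrite leq_mul2r leq_sqr lS orbT.
  have -> : (C * l * (8 * n * l ^ 4) = (8 * C) * (l ^ 5) * n)%N by rewrite (expnS l 4); ring.
  rewrite leq_mul2r; apply/orP; right; rewrite expnMn -expnM.
  apply: leq_mul; last by rewrite leq_pexp2l.
  by apply: leq_trans CC _; rewrite expnS expn1 leq_pmulr.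
have CH : (C * l <= H)%N by rewrite leq_divRL.
have H0 : (0 < H)%N by apply: leq_trans CH; rewrite muln_gt0 C0' l0.
have S1 : (S < N.+1 * (8 * C * l))%N by rewrite ltn_ceil.
have S2 : (N * (8 * C * l) <= S)%N by rewrite leq_trunc_div.
have T1 : (T < H.+1 * (8 * n * l ^ 4))%N by rewrite ltn_ceil.
have T2 : (H * (8 * n * l ^ 4) <= T)%N by rewrite leq_trunc_div.
split=> //.
- apply: leq_trans (ltnW S1) _.
  have -> : (16 * C * l * N = (2 * N) * (8 * C * l))%N by ring.
  by rewrite leq_mul2r; apply/orP; right; lia.
- apply: leq_trans (ltnW T1) _.
  have -> : (16 * n * l ^ 4 * H = (2 * H) * (8 * n * l ^ 4))%N by ring.
  by rewrite leq_mul2r; apply/orP; right; lia.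
- have h1 : (n * l ^ 2 * (2 * l ^ 2 * (2 * H)) * 2 <= T)%N.
    by apply: leq_trans T2; rewrite (expnD l 2 2); apply: eq_leq; ring.
  have h2 : (n * N * (2 * N * (2 * (C * l))) * 2 <= T)%N.
    apply: leq_trans ST; apply: (@leq_trans ((N * (8 * C * l)) ^ 2 * n)%N); last first.
      by rewrite leq_mul2r leq_sqr S2 orbT.
    have -> : ((N * (8 * C * l)) ^ 2 * n = (n * N * (2 * N * (2 * (C * l))) * 2) * (8 * (C * l)))%N by ring.
    by rewrite leq_pmulr // muln_gt0 /= muln_gt0 C0' l0.
  by lia.
Qed.

(** * The schedule and its logarithmic scale *)

Section Schedule.
Context {R : realType}.
Implicit Types (n T : nat) (delta : R).

Definition logs n T delta : R := 1 + ln n%:R + ln T%:R + ln (1 / delta).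
Definition ell n T delta : nat := (Num.truncn (logs n T delta)).+1.
Definition root_ratio n T : nat := Num.truncn (Num.sqrt (T%:R / n%:R : R)).

(** When [T / n] is below a power of [l] the schedule is empty and the starting point is returned:
    the claimed rate then exceeds the initial gap. *)
Definition schedule (C C0 n T : nat) delta : seq (nat * nat) :=
  let l := ell n T delta in let S := root_ratio n T in
  let N := (S %/ (8 * C * l))%N in
  if (C0 * l ^ 3 <= S)%N then
    nseq (n * N) (N, (C * l)%N) ++ nseq (n * l ^ 2) ((l ^ 2)%N, (T %/ (8 * n * l ^ 4))%N)
  else [::].

(** [expR l] equals [expR 1] times [n * T / delta], whose factors [n], [T] and [1 / delta] are all
    at least 1; so [expR k] absorbs each of them. *)
Lemma logs_bounds n T delta : (0 < n)%N -> (0 < T)%N -> 0 < delta < 1 ->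
  let l := logs n T delta in let k := (ell n T delta)%:R in
  [/\ 1 <= l, l <= k, k <= 2 * l, n%:R <= expR k & T%:R <= delta * expR k] /\
  (T%:R <= expR k /\ delta^-1 <= expR k).
Proof.
move=> n0 T0 /andP[d0 d1] l k.
have nR : 1 <= n%:R :> R by rewrite ler1n.
have TR : 1 <= T%:R :> R by rewrite ler1n.
have dR : 1 <= delta^-1 by rewrite invf_ge1 // ltW.
have l1 : 1 <= l.
  by have := ln_ge0 nR; have := ln_ge0 TR; have := ln_ge0 dR; rewrite /l /logs mul1r; lra.
have /andP[k1 k2] : k - 1 <= l < k.
  by have := @truncn_itv R l (le_trans ler01 l1); rewrite /k /ell -/l -natr1 addrK.
have ek : n%:R * T%:R * delta^-1 <= expR k.
  apply: (@le_trans _ _ (expR l)); last by rewrite ler_expR ltW.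
  rewrite /l /logs !expRD !lnK ?posrE ?divr_gt0 ?mul1r //; try lra.
  rewrite -!mulrA ler_peMl //; first by rewrite !mulr_ge0 //; lra.
  by rewrite -expR0 ler_expR.
have nT : 1 <= n%:R * T%:R :> R by rewrite mulr_ege1.
have nTd : 1 <= T%:R * delta^-1 :> R by rewrite mulr_ege1.
have nd : 1 <= n%:R * delta^-1 :> R by rewrite mulr_ege1.
split; [split|split] => //; try lra.
- apply: le_trans ek; rewrite -mulrA ler_peMr //; lra.
- rewrite -ler_pdivrMl // mulrC; apply: le_trans ek.
  by rewrite -mulrA ler_peMl //; lra.
- by apply: le_trans ek; rewrite -mulrA mulrCA ler_peMr //; lra.
- by apply: le_trans ek; rewrite ler_peMl //; lra.
Qed.

Lemma root_ratio_bounds n T : (0 < n)%N ->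
  (root_ratio n T ^ 2 * n <= T)%N /\ Num.sqrt (T%:R / n%:R) <= (root_ratio n T)%:R + 1 :> R.
Proof.
move=> n0; have := @truncn_itv R _ (sqrtr_ge0 (T%:R / n%:R)); rewrite -/(root_ratio n T).
move=> /andP[h1 h2]; split; last by rewrite natr1 ltW.
have nR : 0 < n%:R :> R by rewrite ltr0n.
rewrite -(ler_nat R) natrM natrX -ler_pdivlMr //.
apply: le_trans (_ : Num.sqrt (T%:R / n%:R) ^+ 2 <= _).
  by rewrite lerXn2r ?nnegrE ?sqrtr_ge0.
by rewrite sqr_sqrtr // divr_ge0.
Qed.

End Schedule.

(** * Noise level and comparison with the claimed rates *)

Section Rates.
Context {R : realType}.
Implicit Types (n T N M : nat) (c k delta : R).

Lemma expR_quad_le c a k : 0 < c -> expR (a * k - c * k ^+ 2) <= expR (a ^+ 2 / (4 * c)).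
Proof.
move=> c0; rewrite ler_expR -subr_ge0.
have -> : a ^+ 2 / (4 * c) - (a * k - c * k ^+ 2) = c * (k - a / (2 * c)) ^+ 2.
  by field; rewrite gt_eqF.
by rewrite mulr_ge0 ?sqr_ge0 // ltW.
Qed.

Variables (L Rad : R).
Hypotheses (L0 : 0 < L) (Rad0 : 0 < Rad).

(** The grid must cover the initial gap and a rise of up to [T] in each phase, hence the growth with
    [T]. *)
Definition start_step T : R := Rad + 1 + 2 * T%:R / L.
Definition step_cst : R := Rad + 1 + 2 / L.
Definition noise_cst : R := L * step_cst ^+ 2 / 2 + 4 * (L * Rad ^+ 2 + 1).

Lemma start_step_sq_ge T : L * Rad ^+ 2 + 2 * T%:R <= L * start_step T ^+ 2.
Proof.
have T0 : 0 <= T%:R :> R by [].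
set u := T%:R / L; have u0 : 0 <= u by rewrite divr_ge0 // ltW.
have -> : L * Rad ^+ 2 + 2 * T%:R = L * (Rad ^+ 2 + 2 * u) by rewrite /u; field; rewrite gt_eqF.
have -> : start_step T = Rad + 1 + 2 * u by rewrite /start_step /u mulrA.
rewrite ler_pM2l //; have := mulr_ge0 (ltW Rad0) u0; have := sqr_ge0 u; move: Rad0; nra.
Qed.

Lemma start_step_ge0 T : 0 <= start_step T.
Proof. by rewrite !addr_ge0 ?divr_ge0 ?mulr_ge0 ?(ltW L0) ?(ltW Rad0). Qed.

Lemma noise_cst_gt0 : 0 < noise_cst.
Proof.
rewrite /noise_cst; have : 0 < L * Rad ^+ 2 by rewrite mulr_gt0 ?exprn_gt0.
have : 0 <= L * step_cst ^+ 2 / 2.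
  by apply: divr_ge0 => //; apply: mulr_ge0; [exact: ltW|exact: sqr_ge0].
by lra.
Qed.

Lemma start_gap_le_noise : L * Rad ^+ 2 <= noise_cst.
Proof.
rewrite /noise_cst; have : 0 < L * Rad ^+ 2 by rewrite mulr_gt0 ?exprn_gt0.
have : 0 <= L * step_cst ^+ 2 / 2.
  by apply: divr_ge0 => //; apply: mulr_ge0; [exact: ltW|exact: sqr_ge0].
by lra.
Qed.

(** The left side adds the grid truncation error to the threshold of Markov's inequality. Both decay
    at least like [expR (- (c * M%:R))], as [1 / 4 <= expR (- c)]; the powers of [T] and [1 / delta]
    are paid for by [expR (2 * k)]. *)
Lemma noise_bound T c k delta M (W : R) : (0 < T)%N -> 0 < delta -> 0 <= c <= 1 / 4 ->
  0 <= k -> T%:R <= expR k -> delta^-1 <= expR k -> 0 <= W ->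
  W * (L * start_step T ^+ 2 / (2 * 4 ^+ M)) +
    4 / delta * expR (- (c * M%:R)) * (L * Rad ^+ 2 + T%:R) <=
  noise_cst * (W + 1) * expR (2 * k - c * M%:R).
Proof.
move=> T0 d0 /andP[c0 c1] k0 Tk dk W0.
have TR : 1 <= T%:R :> R by rewrite ler1n.
have iL : 0 < L^-1 by rewrite invr_gt0.
set X := expR k in Tk dk *; set Y := expR (- (c * M%:R)).
have -> : expR (2 * k - c * M%:R) = X ^+ 2 * Y by rewrite expRD -expRM_natl.
have X1 : 1 <= X by rewrite -expR0 ler_expR.
have Y0 : 0 <= Y by exact: expR_ge0.
have Y4 : (4 ^+ M)^-1 <= Y.
  rewrite /Y mulrC -mulrN expRM_natl -exprVn lerXn2r ?nnegrE ?expR_ge0 ?invr_ge0 //.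
  by apply: le_trans (expR_ge1Dx _); lra.
have sX : start_step T <= step_cst * X.
  apply: (@le_trans _ _ (step_cst * T%:R)).
    rewrite /start_step /step_cst; have : 0 <= (Rad + 1) * (T%:R - 1).
      by rewrite mulr_ge0 ?subr_ge0 ?addr_ge0 // ltW.
    by lra.
  by rewrite ler_wpM2l // !addr_ge0 ?divr_ge0 ?(ltW L0) ?(ltW Rad0).
have s2 : start_step T ^+ 2 <= step_cst ^+ 2 * X ^+ 2.
  rewrite -exprMn lerXn2r ?nnegrE ?start_step_ge0 // (le_trans _ sX) ?start_step_ge0 //.
set a := L * step_cst ^+ 2 / 2; set b := 4 * (L * Rad ^+ 2 + 1).
have a0 : 0 <= a.
  by apply: divr_ge0 => //; apply: mulr_ge0; [exact: ltW|exact: sqr_ge0].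
have LR : 0 < L * Rad ^+ 2 by rewrite mulr_gt0 ?exprn_gt0.
have b0 : 0 <= b by rewrite /b; lra.
have XY0 : 0 <= X ^+ 2 * Y by rewrite mulr_ge0 ?sqr_ge0.
have h1 : L * start_step T ^+ 2 / (2 * 4 ^+ M) <= a * (X ^+ 2 * Y).
  rewrite [X in X <= _](_ : _ = L * start_step T ^+ 2 * (4 ^+ M)^-1 / 2); last first.
    by field; rewrite expf_neq0.
  rewrite ler_pdivrMr //.
  have -> : a * (X ^+ 2 * Y) * 2 = L * (step_cst ^+ 2 * X ^+ 2) * Y by rewrite /a; field.
  apply: ler_pM => //; first by apply: mulr_ge0; [exact: ltW|exact: sqr_ge0].
  by rewrite ler_pM2l.
have h2 : 4 / delta * Y * (L * Rad ^+ 2 + T%:R) <= b * (X ^+ 2 * Y).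
  have e1 : L * Rad ^+ 2 + T%:R <= (L * Rad ^+ 2 + 1) * X by nra.
  have -> : b * (X ^+ 2 * Y) = 4 * X * Y * ((L * Rad ^+ 2 + 1) * X) by rewrite /b; ring.
  apply: ler_pM => //; rewrite ?mulr_ge0 ?invr_ge0 ?(ltW d0) //; first lra.
  by rewrite ler_wpM2r // ler_pM2l.
have h1' := ler_wpM2l W0 h1.
have -> : noise_cst = a + b by [].
have := mulr_ge0 W0 (mulr_ge0 b0 XY0); have := mulr_ge0 a0 XY0; lra.
Qed.

End Rates.

Section RateBounds.
Context {R : realType}.
Variables (n T : nat) (delta l k Sq : R).
Hypotheses (lE : l = logs n T delta) (SqE : Sq = Num.sqrt (T%:R / n%:R)).
Hypotheses (n0 : (0 < n)%N) (T0 : (0 < T)%N) (l1 : 1 <= l) (lk : l <= k) (k2l : k <= 2 * l).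

Lemma rate_one_ge (a1 a2 a3 z : R) : 0 < a1 -> a2 * Sq <= z * l ^+ 3 ->
  a1 * expR (- z) <= rate 1 a1 a2 a3 3 n T delta.
Proof.
move=> a10 hz; rewrite /rate eqxx /polylog -/(logs n T delta) -lE -SqE.
have l0 : 0 <= l by exact: le_trans l1.
rewrite powR_mulrn //; have l3 : 1 <= l ^+ 3 by rewrite exprn_ege1.
have l30 : 0 < l ^+ 3 by exact: lt_le_trans l3.
rewrite -[a1 * l ^+ 3 * _]mulrA ler_pM2l //; apply: (@le_trans _ _ (expR (- (a2 / l ^+ 3 * Sq)))).
  by rewrite ler_expR lerN2 mulrAC ler_pdivrMr.
by rewrite ler_peMl // expR_ge0.
Qed.

(** Small budgets: the exponent is at least -1, and the factor [expR 1] in front makes up for it. *)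
Lemma rate_one_trivial (A a2 a3 C0 : R) : 0 < A -> 0 <= a2 -> Sq <= C0 * k ^+ 3 ->
  0 <= C0 -> a2 * (8 * C0) <= 1 -> A <= rate 1 (expR 1 * A) a2 a3 3 n T delta.
Proof.
move=> A0 a20 hS C00 hC; have e1 : 0 < expR 1 :> R by exact: expR_gt0.
apply: (@le_trans _ _ (expR 1 * A * expR (- 1))).
  by apply: le_of_eq; rewrite expRN; field; rewrite gt_eqF.
apply: rate_one_ge; last first.
  rewrite mul1r; have l0 : 0 <= l by exact: le_trans l1.
  have kl : k ^+ 3 <= (2 * l) ^+ 3.
    by rewrite lerXn2r ?nnegrE ?mulr_ge0 // (le_trans l0).
  apply: (@le_trans _ _ (a2 * (C0 * (2 * l) ^+ 3))).
    by rewrite ler_wpM2l // (le_trans hS) // ler_wpM2l.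
  have -> : a2 * (C0 * (2 * l) ^+ 3) = a2 * (8 * C0) * l ^+ 3 by ring.
  by rewrite ler_piMl // exprn_ge0.
by rewrite mulr_gt0.
Qed.

(** Large budgets: half of [c * N] absorbs [4 * k], the other half dominates [a2 * Sq / l ^+ 3]. *)
Lemma rate_one_main (A a2 a3 C c S N : R) : 0 < A -> 0 <= a2 -> 0 <= C -> 0 <= N -> 1 <= S ->
  Sq <= S + 1 -> S <= 16 * C * k * N -> 4 * k <= c / 2 * N -> a2 * (128 * C) <= c ->
  A * expR (4 * k - c * N) <= rate 1 (expR 1 * A) a2 a3 3 n T delta.
Proof.
move=> A0 a20 C0 N0 S1 SqS SN kN hC.
have l0 : 0 <= l by exact: le_trans l1.
have e1 : 1 <= expR 1 :> R by rewrite -[1 in X in X <= _]expR0 ler_expR.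
apply: (@le_trans _ _ (expR 1 * A * expR (- (c / 2 * N)))).
  apply: ler_pM; rewrite ?expR_ge0 ?(ltW A0) //; last by rewrite ler_expR; lra.
  by rewrite ler_peMl // ltW.
apply: rate_one_ge; first by rewrite mulr_gt0 // expR_gt0.
have h1 : Sq <= 64 * C * l * N.
  have : C * N * k <= C * N * (2 * l) by rewrite ler_wpM2l // mulr_ge0.
  lra.
apply: le_trans (ler_wpM2l a20 h1) _.
have l13 : l <= l ^+ 3 by rewrite exprS ler_peMr // exprn_ege1.
have lN : 0 <= l * N by rewrite mulr_ge0.
have := ler_wpM2r lN hC.
have c0 : 0 <= c by apply: le_trans hC; rewrite !mulr_ge0.
have := ler_wpM2l (mulr_ge0 c0 N0) l13.
by lra.
Qed.

Section KappaGt1.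
Variables (kappa : R) (kgt : 1 < kappa).
Let gam := 1 / (2 * (kappa - 1)).
(** [6 * gam] comes from a factor [k ^+ 6] under the power [gam], and 4 from the order [k ^+ 4] of
    comparisons per coordinate. *)
Let p := 6 * gam + 4.

Lemma gam_gt0 : 0 < gam.
Proof. by rewrite divr_gt0 // mulr_gt0 // subr_gt0. Qed.

Lemma rate_gt1E (a1 a2 a3 : R) :
  rate kappa a1 a2 a3 p n T delta = a3 * l `^ p * n%:R * (n%:R / T%:R) `^ gam.
Proof. by rewrite /rate gt_eqF // /polylog -/(logs n T delta) -lE. Qed.

Let nR : 1 <= n%:R :> R. Proof. by rewrite ler1n. Qed.
Let TR : 1 <= T%:R :> R. Proof. by rewrite ler1n. Qed.
Let l0 : 0 <= l. Proof. exact: le_trans l1. Qed.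
Let ratio0 : 0 < n%:R / T%:R :> R. Proof. by rewrite divr_gt0 // ltr0n. Qed.

Lemma powR_p (z : R) : 0 < z -> z `^ p = (z ^+ 6) `^ gam * z ^+ 4.
Proof.
move=> z0; have z00 := ltW z0.
by rewrite powRD ?(gt_eqF z0) ?implybT // powRrM !powR_mulrn.
Qed.

(** Small budgets: [T / n] is at most a constant times [l ^+ 6], so the polylogarithm keeps the rate
    above a constant. *)
Lemma rate_gt1_trivial (A a1 a2 a3 C0 : R) : 0 < A -> 0 <= C0 -> Sq <= C0 * k ^+ 3 ->
  A * (64 * C0 ^+ 2) `^ gam <= a3 -> A <= rate kappa a1 a2 a3 p n T delta.
Proof.
move=> A0 C00 hS ha; rewrite rate_gt1E.
have Sq0 : 0 <= Sq by rewrite SqE sqrtr_ge0.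
have kl : k ^+ 3 <= (2 * l) ^+ 3.
  by rewrite lerXn2r ?nnegrE ?mulr_ge0 // (le_trans l0).
have hT : T%:R / n%:R <= 64 * C0 ^+ 2 * l ^+ 6.
  have -> : T%:R / n%:R = Sq ^+ 2 by rewrite SqE sqr_sqrtr // divr_ge0.
  have -> : 64 * C0 ^+ 2 * l ^+ 6 = (C0 * (2 * l) ^+ 3) ^+ 2 by ring.
  rewrite lerXn2r ?nnegrE ?mulr_ge0 ?exprn_ge0 ?mulr_ge0 //.
  by rewrite (le_trans hS) // ler_wpM2l.
have one : 1 <= (64 * C0 ^+ 2) `^ gam * (l ^+ 6) `^ gam * (n%:R / T%:R) `^ gam.
  have q0 : 0 <= 64 * C0 ^+ 2 by rewrite mulr_ge0 ?sqr_ge0.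
  have q1 : 0 <= l ^+ 6 by rewrite exprn_ge0.
  rewrite -powRM // -powRM ?mulr_ge0 // ?(ltW ratio0) //.
  rewrite [X in X <= _](_ : _ = 1 `^ gam); last by rewrite powR1.
  apply: ge0_ler_powR; first exact: ltW gam_gt0.
  - by rewrite nnegrE.
  - by rewrite nnegrE; apply: mulr_ge0; [apply: mulr_ge0|exact: ltW].
  rewrite -ler_pdivrMr // mul1r; apply: le_trans hT.
  by rewrite invf_div.
have l4 : 1 <= l ^+ 4 by rewrite exprn_ege1.
rewrite powR_p ?(lt_le_trans _ l1) //.
set u := (64 * C0 ^+ 2) `^ gam in one ha; set v := (l ^+ 6) `^ gam in one *.
set w := (n%:R / T%:R) `^ gam in one *.
have u0 : 0 <= u by exact: powR_ge0.
have v0 : 0 <= v by exact: powR_ge0.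
have w0 : 0 <= w by exact: powR_ge0.
apply: (@le_trans _ _ (A * (u * v * w))); first by rewrite ler_peMr // ltW.
have -> : A * (u * v * w) = A * u * v * w by ring.
rewrite ler_wpM2r //; apply: (@le_trans _ _ (a3 * v)); first by rewrite ler_wpM2r.
have a30 : 0 <= a3 by apply: le_trans ha; rewrite mulr_ge0 // ltW.
have av : 0 <= a3 * v by rewrite mulr_ge0.
rewrite mulrA -[a3 * v * _ * _]mulrA ler_peMr //.
by rewrite mulr_ege1.
Qed.

(** Large budgets: the first term is the accumulated resolution, with [C * k / H] of order [n / T]
    up to logarithms. The second decays faster than any power of [T], because [expR k] is at least
    [T]. *)
Lemma rate_gt1_main (A a1 a2 a3 C c H : R) : 0 < A -> 0 <= C -> 0 < c -> 0 < H ->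
  T%:R <= expR k -> T%:R <= 16 * n%:R * k ^+ 4 * H ->
  2 * (16 * C) `^ gam * 2 `^ p + A * expR ((4 + gam) ^+ 2 / (4 * c)) <= a3 ->
  n%:R * (2 * k ^+ 4 * (C * k / H) `^ gam) + n%:R * A * expR (4 * k - c * k ^+ 2) <=
  rate kappa a1 a2 a3 p n T delta.
Proof.
move=> A0 C00 c0 H0 Tk TH ha; rewrite rate_gt1E.
have k1 : 1 <= k by exact: le_trans lk.
have k0 : 0 < k by exact: lt_le_trans k1.
have T00 : 0 < T%:R :> R by rewrite ltr0n.
have g0 := gam_gt0.
set w := (n%:R / T%:R) `^ gam; have w0 : 0 <= w by exact: powR_ge0.
have lp1 : 1 <= l `^ p.
  rewrite -(powRr0 l); apply: ler_powR => //; rewrite /p; lra.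
have h1 : k ^+ 4 * (C * k / H) `^ gam <= (16 * C) `^ gam * 2 `^ p * l `^ p * w.
  have k6 : 0 <= k ^+ 6 by rewrite exprn_ge0 // ltW.
  have le1 : C * k / H <= (16 * C) * k ^+ 6 * (n%:R / T%:R).
    rewrite ler_pdivrMr // mulrAC mulrA ler_pdivlMr //.
    apply: (@le_trans _ _ (C * k * (16 * n%:R * k ^+ 4 * H))).
      by rewrite ler_wpM2l // mulr_ge0 // ltW.
    have -> : C * k * (16 * n%:R * k ^+ 4 * H) = 16 * C * n%:R * H * k ^+ 5 by ring.
    have -> : 16 * C * k ^+ 6 * H * n%:R = 16 * C * n%:R * H * k ^+ 6 by ring.
    by rewrite ler_wpM2l ?mulr_ge0 ?(ltW H0) // [X in _ <= X]exprS ler_peMl // exprn_ge0 // ltW.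
  have le2 : (C * k / H) `^ gam <= (16 * C) `^ gam * (k ^+ 6) `^ gam * w.
    have C16 : 0 <= 16 * C by rewrite mulr_ge0.
    have Ck : 0 <= 16 * C * k ^+ 6 by exact: mulr_ge0.
    rewrite -powRM // -powRM //.
    apply: ge0_ler_powR => //; first exact: ltW.
    - by rewrite nnegrE; apply: divr_ge0; [apply: mulr_ge0 => //; exact: ltW|exact: ltW].
    - by rewrite nnegrE; apply: mulr_ge0 => //; exact: ltW.
  apply: le_trans (ler_wpM2l (exprn_ge0 4 (ltW k0)) le2) _.
  have -> : k ^+ 4 * ((16 * C) `^ gam * (k ^+ 6) `^ gam * w) =
    (16 * C) `^ gam * w * k `^ p by rewrite powR_p //; ring.
  have -> : (16 * C) `^ gam * 2 `^ p * l `^ p * w = (16 * C) `^ gam * w * (2 * l) `^ p.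
    by rewrite (@powRM _ 2 l) //; ring.
  rewrite ler_wpM2l ?mulr_ge0 ?powR_ge0 //; apply: ge0_ler_powR; rewrite ?nnegrE //.
  - by rewrite /p; lra.
  - exact: ltW.
  - by rewrite mulr_ge0.
have h2 : expR (4 * k - c * k ^+ 2) <= expR ((4 + gam) ^+ 2 / (4 * c)) * w.
  (* The factor [expR (- k * gam)] is split off to pay for the power of [n / T]; completing the
     square bounds the rest by a constant. *)
  have -> : 4 * k - c * k ^+ 2 = ((4 + gam) * k - c * k ^+ 2) + (- k) * gam by ring.
  rewrite expRD; apply: ler_pM; rewrite ?expR_ge0 ?expR_quad_le //.
  rewrite expRM; apply: ge0_ler_powR; rewrite ?nnegrE ?expR_ge0 ?(ltW g0) ?(ltW ratio0) //.
  rewrite expRN; apply: (@le_trans _ _ (T%:R^-1)).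
    by rewrite lef_pV2 ?posrE ?expR_gt0.
  by rewrite ler_peMl // invr_ge0.
set G := expR ((4 + gam) ^+ 2 / (4 * c)) in ha h2.
set u := (16 * C) `^ gam * 2 `^ p in ha h1.
have G0 : 0 <= G by exact: expR_ge0.
have AGw : 0 <= A * G * w by rewrite !mulr_ge0 // ltW.
have n00 : 0 <= n%:R :> R by [].
have h2' := ler_wpM2l (ltW A0) h2.
have lw : 0 <= l `^ p * w by rewrite mulr_ge0 // powR_ge0.
have h3 := ler_wpM2r lw ha.
have h4 : A * G * w <= A * G * (l `^ p * w).
  by rewrite ler_wpM2l ?mulr_ge0 ?(ltW A0) // ler_peMl.
have h5 : 2 * k ^+ 4 * (C * k / H) `^ gam + A * expR (4 * k - c * k ^+ 2) <= a3 * (l `^ p * w).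
  by move: h3; rewrite -[2 * _ * 2 `^ p]mulrA -/u; lra.
have -> : a3 * l `^ p * n%:R * w = n%:R * (a3 * (l `^ p * w)) by ring.
by rewrite -[n%:R * A * _]mulrA -mulrDr ler_wpM2l.
Qed.

End KappaGt1.
End RateBounds.

(** * Assembling the guarantee *)

Lemma cost_two_phases K1 J1 H1 K2 J2 H2 :
  cost (nseq K1 (J1, H1) ++ nseq K2 (J2, H2)) =
  (K1 * (2 * J1 * (2 * H1)) + K2 * (2 * J2 * (2 * H2)))%N.
Proof. by rewrite /cost map_cat !map_nseq sumn_cat !sumn_nseq /=; lia. Qed.

Lemma valid_two_phases K1 J1 H1 K2 J2 H2 :
  (0 < J1)%N -> (0 < H1)%N -> (0 < J2)%N -> (0 < H2)%N ->
  valid (nseq K1 (J1, H1) ++ nseq K2 (J2, H2)).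
Proof. by move=> *; rewrite /valid all_cat !all_nseq /=; apply/andP; split; apply/orP; right; apply/andP. Qed.

(** The number of comparisons consumes one factor [expR (- k)] and leaves [delta]; the other factor
    is at most 1/2. *)
Lemma union_bound {R : realType} (cnt T : nat) (delta k : R) :
  (cnt <= T)%N -> T%:R <= delta * expR k -> 1 <= k -> 0 < delta ->
  cnt%:R * expR (- (2 * k)) <= delta / 2.
Proof.
move=> cT Tk k1 d0; have e0 : 0 < expR k by exact: expR_gt0.
have e2 : 2 <= expR k by apply: le_trans (expR_ge1Dx k); lra.
have -> : expR (- (2 * k)) = (expR k)^-1 * (expR k)^-1.
  by rewrite -expRN -expRD; congr expR; ring.
have c1 : cnt%:R * (expR k)^-1 <= delta.
  by rewrite ler_pdivrMr // (le_trans _ Tk) // ler_nat.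
rewrite mulrA; apply: ler_pM => //; rewrite ?mulr_ge0 ?invr_ge0 ?expR_ge0 //.
by rewrite lef_pV2 ?posrE.
Qed.

Section Guarantee.
Context {R : realType}.
Variables (tau L Rad : R) (n T : nat) (delta : R).
Hypotheses (tau0 : 0 < tau) (tauL : tau <= L) (Rad0 : 0 < Rad).
Hypotheses (n0 : (0 < n)%N) (T0 : (0 < T)%N) (d01 : 0 < delta < 1).
Variables (f : 'rV[R]_n -> R) (g : 'rV[R]_n -> 'rV[R]_n) (xs : 'rV[R]_n).
Hypothesis convf : forall x y, f x + dotv (g x) (y - x) + tau / 2 * enorm (x - y) ^+ 2 <= f y.
Hypothesis lipf : forall x y, enorm (g x - g y) <= L * enorm (x - y).
Hypothesis xsmin : is_minimizer f xs.
Hypothesis xsRad : enorm (xs - 0) <= Rad.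
Variables (kappa mu delta0 : R) (q : 'rV[R]_n -> 'rV[R]_n -> R).
Hypothesis orac : comparison_oracle kappa mu delta0 f q.
Hypotheses (mu0 : 0 < mu) (del0 : 0 < delta0) (del1 : delta0 <= 1 / 2).

Let L0 : 0 < L. Proof. exact: lt_le_trans tauL. Qed.
Local Notation c := (tau / (4 * L)).
Local Notation g1 := (Num.min mu delta0).
Local Notation s0 := (start_step L Rad T).
Local Notation A := (noise_cst L Rad).
Local Notation k := (ell n T delta).
Local Notation l := (logs n T delta).
Local Notation S := (root_ratio (R := R) n T).

Variables (C C0 : nat).
Hypothesis Cg : 2 <= 3 * g1 ^+ 2 * C%:R.
Hypothesis CC0 : (8 * C <= C0)%N.
Hypothesis C0c : 128 * C%:R <= c * C0%:R.

Local Notation N := (S %/ (8 * C * k))%N.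
Local Notation H2 := (T %/ (8 * n * k ^ 4))%N.
Local Notation alg := (sched_alg s0 (schedule C C0 n T delta)).

Let q01 x y : 0 <= q x y <= 1. Proof. by case: orac. Qed.

Lemma success_ge r sched : valid sched -> (cost sched <= T)%N ->
  sched_exp q s0 (fun x => (r < f x - f xs)%R%:R) sched 0 <= delta ->
  1 - delta <= success_prob (sched_alg s0 sched) q T (fun x => f x - f xs <= r).
Proof.
move=> vs cT hb; rewrite /success_prob run_expect_sched //.
have -> : (fun x => (f x - f xs <= r)%R%:R : R) = (fun x => 1 - (r < f x - f xs)%R%:R).
  by apply/funext => x; case: leP => _ /=; rewrite ?mulr1n ?mulr0n ?subr0 ?subrr.
by rewrite sched_exp_compl //; lra.
Qed.

Lemma start_gap : f 0 - f xs <= L * Rad ^+ 2.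
Proof.
apply: le_trans (initial_gap tau0 tauL convf lipf xsmin 0) _.
by rewrite ler_pM2l // lerXn2r ?nnegrE ?sqrtr_ge0 // ltW.
Qed.

Lemma trivial_regime r : (S < C0 * k ^ 3)%N -> L * Rad ^+ 2 <= r ->
  1 - delta <= success_prob alg q T (fun x => f x - f xs <= r).
Proof.
rewrite ltnNge /schedule => /negbTE -> hr; apply: success_ge => //=.
have := start_gap; case: ltP => /=; first by lra.
by case/andP: d01; lra.
Qed.

Lemma sqrt_ratio_le_trivial : (S < C0 * k ^ 3)%N -> Num.sqrt (T%:R / n%:R) <= C0%:R * k%:R ^+ 3 :> R.
Proof.
move=> lt; have [_ h] := @root_ratio_bounds R n T n0; apply: le_trans h _.
by rewrite natr1 -natrX -natrM ler_nat.
Qed.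

Let c01 : 0 < c <= 1 / 4.
Proof. by rewrite divr_gt0 ?mulr_gt0 //= ler_pdivrMr ?mulr_gt0 //; move: tauL; lra. Qed.

Let g101 : 0 < g1 <= 1 / 2.
Proof. by rewrite lt_min mu0 del0 ge_min del1 orbT. Qed.

Let C_gt0 : (0 < C)%N.
Proof. by case: C Cg => //; rewrite mulr0 lt_geF. Qed.

Let e0 : R := L * Rad ^+ 2 + T%:R.

Let e0_gt0 : 0 < e0.
Proof. by rewrite /e0 addr_gt0 ?mulr_gt0 ?exprn_gt0 // ltr0n. Qed.

(** The factor [4 / delta] makes Markov's bound exactly [delta / 4]; it multiplies the contracted
    gap only, so the logarithms absorb it. *)
Let theta M := 4 / delta * expR (- (c * M%:R)) * e0.

Let theta_gt0 M : 0 < theta M.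
Proof. by case/andP: d01 => d0 _; rewrite /theta !mulr_gt0 ?invr_gt0 ?expR_gt0. Qed.

Let markov M : expR (- (c * M%:R)) * e0 / theta M = delta / 4.
Proof.
have /andP[d0 _] := d01; rewrite /theta.
by field; rewrite !gt_eqF ?expR_gt0.
Qed.

(** The failure budget is [delta / 4] from Markov's inequality plus [delta / 2] from the union bound
    over all comparisons. *)
Lemma nontrivial_success r : (C0 * k ^ 3 <= S)%N ->
  sched_exp q s0 (fun x => (r < f x - f xs)%R%:R)
    (nseq (n * N) (N, (C * k)%N) ++ nseq (n * k ^ 2) ((k ^ 2)%N, H2)) 0 <=
  delta / 4 + (n * N * (2 * N) + n * k ^ 2 * (2 * k ^ 2))%N%:R * expR (- (2 * k%:R)) ->
  1 - delta <= success_prob alg q T (fun x => f x - f xs <= r).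
Proof.
move=> big hb; have [Sn _] := @root_ratio_bounds R n T n0.
have [N0 CH SN TH cT] := schedule_arith n0 C_gt0 (ltn0Sn _) Sn CC0 big.
have k0 : (0 < C * k)%N by rewrite muln_gt0 C_gt0.
have H0 : (0 < H2)%N by apply: leq_trans CH.
have k20 : (0 < k ^ 2)%N by rewrite expn_gt0.
have [[l1 lk k2l nk Tdk] _] := logs_bounds n0 T0 d01.
have /andP[d0 _] := d01.
rewrite /schedule big; apply: success_ge.
- exact: valid_two_phases.
- by rewrite cost_two_phases; apply: leq_trans cT; rewrite leqnn.
apply: le_trans hb _.
have cnt : (n * N * (2 * N) + n * k ^ 2 * (2 * k ^ 2) <= T)%N.
  apply: leq_trans cT; apply: leq_add; rewrite leq_mul2l; apply/orP; right;
    by rewrite leq_pmulr // muln_gt0.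
by have := union_bound cnt Tdk (le_trans l1 lk) d0; lra.
Qed.

(** [y] is the fraction of the full bias [g1] guaranteed beyond the resolution, so the votes
    required grow like [1 / y ^+ 2]. *)
Let oracle_acc H D y : 0 <= D -> 0 <= y <= 1 -> (C * k)%N%:R <= y ^+ 2 * H%:R ->
  (forall z, D < z -> y <= z `^ (kappa - 1)) ->
  accurate q f H D (expR (- (2 * k%:R))).
Proof.
move=> D0 /andP[y0 y1] hH hz; have /andP[gg0 gg1] := g101.
apply: (oracle_accurate (g := g1 * y) orac D0).
- by rewrite mulr_ge0 ?(ltW gg0) //= (le_trans _ gg1) // ler_piMr // ltW.
- move=> z Dz; rewrite le_min; apply/andP; split.
    by rewrite (le_trans (_ : _ <= g1)) ?ler_piMr ?(ltW gg0) // ge_min lexx orbT.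
  by apply: ler_pM; rewrite ?(ltW gg0) ?hz // ge_min lexx.
- have k0 : 0 <= k%:R :> R by [].
  have g20 : 0 <= 3 * g1 ^+ 2 by rewrite mulr_ge0 // sqr_ge0.
  have := ler_wpM2l g20 hH; have := ler_wpM2r k0 Cg; rewrite natrM exprMn; lra.
Qed.

Lemma success_eq1 a2 a3 : kappa = 1 -> 0 <= a2 -> a2 * (128 * C%:R) <= c -> a2 * (8 * C0%:R) <= 1 ->
  1 - delta <= success_prob alg q T
    (fun x => f x - f xs <= rate kappa (expR 1 * A) a2 a3 3 n T delta).
Proof.
move=> k1 a20 a2C a2C0; have [[l1 lk k2l nk Tdk] [Tk dk]] := logs_bounds n0 T0 d01.
have A0 := noise_cst_gt0 L0 Rad0.
have /andP[d0 d1] := d01; have /andP[c0 c1] := c01.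
have kR : 1 <= k%:R :> R by exact: le_trans lk.
rewrite k1; have [big|small] := leqP (C0 * k ^ 3) S; last first.
  apply: trivial_regime => //; apply: (le_trans (start_gap_le_noise L0 Rad0)).
  by apply: (rate_one_trivial (erefl _) (erefl _) l1 lk k2l _ A0 a20 (sqrt_ratio_le_trivial small) _ a2C0).
have [Sn SqS] := @root_ratio_bounds R n T n0.
have [N0 CH SN TH cT] := schedule_arith n0 C_gt0 (ltn0Sn _) Sn CC0 big.
(* For [kappa = 1] the bias is at least [g1] at every nonzero gap, so [y = 1] works with resolution
   0. *)
have acc H : (C * k <= H)%N -> accurate q f H 0 (expR (- (2 * k%:R))).
  move=> CkH; apply: (oracle_acc (y := 1)); rewrite ?lexx ?ler01 //.
    by rewrite expr1n mul1r ler_nat.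
  by move=> z _; rewrite k1 subrr powRr0.
apply: (nontrivial_success big); rewrite -(markov N).
apply: (bad_prob_phase1 tau0 tauL convf lipf xsmin q01 n0 _ _ _ _ (theta_gt0 N) (acc _ (leqnn _)) (acc _ CH)).
- exact: expR_ge0.
- exact: start_step_ge0.
- by apply: le_trans start_gap _; rewrite lerDl.
- by apply: le_trans (start_step_sq_ge L0 Rad0 T); rewrite lerD2l ler_peMl // ler1n.
apply: le_trans (noise_bound L0 Rad0 N T0 d0 _ _ Tk dk _) _ => //.
- by rewrite (ltW c0).
have nN : (n * N)%:R + 1 <= expR (2 * k%:R) :> R.
  apply: (@le_trans _ _ T%:R); last by apply: le_trans Tk _; rewrite ler_expR; lra.
  rewrite natr1 ler_nat; apply: leq_trans cT.
  apply: leq_trans (leq_addr _ _); apply: ltn_Pmulr; last by rewrite muln_gt0 n0.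
  by apply: (@leq_trans (2 * N)); rewrite leq_pmulr // muln_gt0 //= muln_gt0 C_gt0.
apply: (@le_trans _ _ (A * expR (4 * k%:R - c * N%:R))).
  rewrite -mulrA ler_pM2l //.
  have -> : 4 * k%:R - c * N%:R = 2 * k%:R + (2 * k%:R - c * N%:R) by ring.
  by rewrite [expR (_ + (_ + _))]expRD ler_wpM2r // expR_ge0.
have S1 : (0 < S)%N.
  by apply: leq_trans big; rewrite muln_gt0 expn_gt0 /= andbT (leq_trans _ CC0) // muln_gt0.
apply: (rate_one_main (erefl _) (erefl _) l1 k2l _ A0 a20 (ler0n _ C) (ler0n _ N) _ SqS _ _ a2C).
- by rewrite ler1n.
- by rewrite -!natrM ler_nat.
have C0' : 0 < C%:R :> R by rewrite ltr0n.
(* The large-budget condition yields [8 * k ^ 2 <= c * N], which implies the required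
   [4 * k <= c / 2 * N]. *)
have h1 : C0%:R * k%:R ^+ 3 <= 16 * C%:R * k%:R * N%:R :> R.
  by rewrite -natrX -!natrM ler_nat (leq_trans big).
have h2 := ler_wpM2l (ltW c0) h1.
have h3 := ler_wpM2r (exprn_ge0 3 (le_trans ler01 kR)) C0c.
have h4 : 128 * k%:R ^+ 3 * C%:R <= 16 * c * k%:R * N%:R * C%:R by lra.
rewrite ler_pM2r // in h4.
have h5 : (8 * k%:R ^+ 2) * k%:R <= (c * N%:R) * k%:R by rewrite -mulrA -exprSr; lra.
rewrite ler_pM2r in h5; last by lra.
have : k%:R <= k%:R ^+ 2 :> R by rewrite expr2 ler_peMr //; lra.
by lra.
Qed.

Lemma success_gt1 a1 a2 a3 (gam := 1 / (2 * (kappa - 1))) : 1 < kappa ->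
  A * (64 * C0%:R ^+ 2) `^ gam <= a3 ->
  2 * (16 * C%:R) `^ gam * 2 `^ (6 * gam + 4) + A * expR ((4 + gam) ^+ 2 / (4 * c)) <= a3 ->
  1 - delta <= success_prob alg q T
    (fun x => f x - f xs <= rate kappa a1 a2 a3 (6 * gam + 4) n T delta).
Proof.
move=> k1 ha ha'; have [[l1 lk k2l nk Tdk] [Tk dk]] := logs_bounds n0 T0 d01.
have A0 := noise_cst_gt0 L0 Rad0.
have /andP[d0 d1] := d01; have /andP[c0 c1] := c01.
have kR : 1 <= k%:R :> R by exact: le_trans lk.
have [big|small] := leqP (C0 * k ^ 3) S; last first.
  apply: trivial_regime => //; apply: (le_trans (start_gap_le_noise L0 Rad0)).
  by apply: (rate_gt1_trivial (erefl _) (erefl _) n0 T0 l1 lk k2l k1 _ _ A0 _ (sqrt_ratio_le_trivial small) ha).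
have [Sn SqS] := @root_ratio_bounds R n T n0.
have [N0 CH SN TH cT] := schedule_arith n0 C_gt0 (ltn0Sn _) Sn CC0 big.
have Ck0 : 0 < (C * k)%:R :> R by rewrite ltr0n muln_gt0 C_gt0.
have H0 : 0 < H2%:R :> R by apply: lt_le_trans Ck0 _; rewrite ler_nat.
have gam0 : 0 < gam by exact: gam_gt0.
(* [b] is the ratio of the votes needed at full bias to those available, so the bias fraction
   [Num.sqrt b] is enough; [D] is the gap whose power [kappa - 1] equals it. *)
pose b := C%:R * k%:R / H2%:R : R.
have b0 : 0 < b by rewrite /b -natrM divr_gt0.
have b1 : b <= 1 by rewrite /b -natrM ler_pdivrMr // mul1r ler_nat.
pose D := b `^ gam; have D0 : 0 <= D by exact: powR_ge0.
have D1 : D <= 1.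
  rewrite [X in _ <= X](_ : _ = 1 `^ gam); last by rewrite powR1.
  by apply: ge0_ler_powR; rewrite ?nnegrE ?(ltW gam0) ?(ltW b0).
have kap0 : 0 <= kappa - 1 by lra.
have acc1 : accurate q f (C * k) 1 (expR (- (2 * k%:R))).
  apply: (oracle_acc (y := 1)); rewrite ?lexx ?ler01 //.
    by rewrite expr1n mul1r.
  move=> z z1; rewrite [X in X <= _](_ : _ = 1 `^ (kappa - 1)); last by rewrite powR1.
  by apply: ge0_ler_powR; rewrite ?nnegrE //; lra.
have acc2 : accurate q f H2 D (expR (- (2 * k%:R))).
  apply: (oracle_acc (y := Num.sqrt b)) => //.
  - by rewrite sqrtr_ge0 -[X in _ <= X]sqrtr1 ler_sqrt.
  - by rewrite sqr_sqrtr ?(ltW b0) // /b -natrM divfK // gt_eqF.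
  move=> z Dz; have -> : Num.sqrt b = D `^ (kappa - 1).
    rewrite -powRrM -powR12_sqrt ?(ltW b0) //; congr (_ `^ _); rewrite /gam.
    by field; rewrite subr_eq0 gt_eqF.
  by apply: ge0_ler_powR; rewrite ?nnegrE //; lra.
apply: (nontrivial_success big); rewrite -(markov (k ^ 2)).
(* Both phases together make at most [T] comparisons; with resolutions at most 1 the gap stays
   within the range of the grid. *)
have K1T : (n * N * (2 * N))%:R + (n * k ^ 2 * (2 * k ^ 2))%:R <= T%:R :> R.
  have H0n : (0 < H2)%N by rewrite -(ltr0n R).
  rewrite -natrD ler_nat; apply: leq_trans cT; apply: leq_add; rewrite leq_mul2l; apply/orP; right;
    by rewrite leq_pmulr // muln_gt0 //= muln_gt0 C_gt0.
have K1p : 0 <= (n * N * (2 * N))%:R :> R by [].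
have K2p : 0 <= (n * k ^ 2 * (2 * k ^ 2))%:R :> R by [].
apply: (bad_prob_phase2 tau0 tauL convf lipf xsmin q01 n0 _ _ (theta_gt0 _) acc1 acc2 D0).
- exact: expR_ge0.
- exact: start_step_ge0.
- by have := start_gap; rewrite /e0; lra.
- apply: le_trans (start_step_sq_ge L0 Rad0 T); have := ler_wpM2l K2p D1; rewrite /e0; lra.
set zt := L * _ / _.
have nb : (n * k ^ 2)%:R * zt + theta (k ^ 2) <= n%:R * A * expR (4 * k%:R - c * k%:R ^+ 2).
  apply: le_trans (noise_bound L0 Rad0 (k ^ 2) T0 d0 _ _ Tk dk _) _ => //.
  - by rewrite (ltW c0).
  have nR : 1 <= n%:R :> R by rewrite ler1n.
  have e2 : k%:R ^+ 2 + 1 <= expR (2 * k%:R) :> R.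
    rewrite expRM_natl; apply: (@le_trans _ _ ((1 + k%:R) ^+ 2)); first by lra.
    by rewrite lerXn2r ?nnegrE ?expR_ge0 ?expR_ge1Dx //; lra.
  rewrite natrX.
  have -> : 4 * k%:R - c * k%:R ^+ 2 = 2 * k%:R + (2 * k%:R - c * k%:R ^+ 2) by ring.
  rewrite [expR (_ + (_ + _))]expRD mulrA ler_wpM2r ?expR_ge0 // [n%:R * A]mulrC -mulrA ler_pM2l //.
  apply: (@le_trans _ _ (n%:R * (k%:R ^+ 2 + 1))); last by rewrite ler_wpM2l.
  by rewrite natrM natrX mulrDr mulr1 lerD2l.
apply: (@le_trans _ _ (n%:R * (2 * k%:R ^+ 4 * D) + n%:R * A * expR (4 * k%:R - c * k%:R ^+ 2))).
  by rewrite mulrDr -addrA; apply: lerD => //; apply: le_of_eq; rewrite !natrM ?natrX; ring.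
apply: (rate_gt1_main (erefl _) n0 T0 l1 lk k2l k1 _ _ A0 (ler0n _ C) c0 H0 Tk _ ha').
by rewrite -natrX -!natrM ler_nat.
Qed.

End Guarantee.

Theorem theorem2 (R : realType) (tau L mu delta0 Rad : R) :
  0 < tau -> tau <= L -> 0 < mu -> 0 < delta0 -> delta0 <= 1 / 2 -> 0 < Rad ->
  (* the algorithm may depend on n, T, delta and the class/oracle parameters,
     but not on kappa *)
  exists Alg : forall n : nat, nat -> R -> cd_alg R n,
  forall kappa : R, 1 <= kappa -> (kappa = 1 -> mu <= delta0) ->
  exists a1 a2 a3 p : R, [/\ 0 < a1, 0 < a2, 0 < a3, 0 <= p &
  forall (n T : nat) (delta : R), (0 < n)%N -> (0 < T)%N -> 0 < delta < 1 ->
  forall f : 'rV[R]_n -> R, in_class tau L f ->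
  forall q : 'rV[R]_n -> 'rV[R]_n -> R, comparison_oracle kappa mu delta0 f q ->
  forall xs : 'rV[R]_n, is_minimizer f xs ->
  enorm (xs - cd_x0 (Alg n T delta)) <= Rad ->
  1 - delta <=
    success_prob (Alg n T delta) q T
      (fun x => f x - f xs <= rate kappa a1 a2 a3 p n T delta)].
Proof.
move=> tau0 tauL mu0 del0 del1 Rad0.
have L0 : 0 < L by exact: lt_le_trans tauL.
set c := tau / (4 * L); have c0 : 0 < c by rewrite divr_gt0 ?mulr_gt0.
set g1 := Num.min mu delta0; have g10 : 0 < g1 by rewrite lt_min mu0 del0.
(* [C] lets [C * k] pairs of votes at bias [g1] err with probability at most [expR (- (2 * k))];
   [C0] serves the budget split and the absorption of [4 * k]. *)
pose C := Num.bound (2 / (3 * g1 ^+ 2)); pose C0 := (8 * C + Num.bound (128 * C%:R / c))%N.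
have Cg : 2 <= 3 * g1 ^+ 2 * C%:R.
  have g20 : 0 < 3 * g1 ^+ 2 by rewrite mulr_gt0 // exprn_gt0.
  by rewrite mulrC -ler_pdivrMr // ltW // archi_boundP // divr_ge0 // ltW.
have C_gt0 : 0 < C%:R :> R.
  by rewrite ltr0n lt0n; apply/eqP => Cz; move: Cg; rewrite Cz mulr0 lt_geF.
have CC0 : (8 * C <= C0)%N by rewrite leq_addr.
have C0c : 128 * C%:R <= c * C0%:R.
  rewrite -ler_pdivrMl // [c^-1 * _]mulrC.
  apply: (@le_trans _ _ (Num.bound (128 * C%:R / c))%:R).
    apply/ltW/archi_boundP; apply: divr_ge0 (ltW c0).
    exact: mulr_ge0 (ltW C_gt0).
  by rewrite ler_nat leq_addl.
have C0_gt0 : 0 < C0%:R :> R by apply: lt_le_trans C_gt0 _; rewrite ler_nat; lia.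
have A0 := noise_cst_gt0 L0 Rad0.
exists (fun n T delta => sched_alg (start_step L Rad T) (schedule C C0 n T delta)).
move=> kappa; rewrite le_eqVlt => /orP[/eqP k1|k1] mud.
  (* The two terms serve the large and the small budgets respectively. *)
  pose a2 := Num.min (c / (128 * C%:R)) (1 / (8 * C0%:R)).
  have a20 : 0 < a2 by rewrite lt_min !divr_gt0 ?mulr_gt0.
  exists (expR 1 * noise_cst L Rad), a2, 1, 3; split=> //; first by rewrite mulr_gt0 ?expR_gt0.
  move=> n T delta n0 T0 d01 f [g [_ convf lipf _]] q orac xs xsmin xsR.
  apply: (success_eq1 tau0 tauL Rad0 n0 T0 d01 convf lipf xsmin xsR orac) => //.
  - exact: ltW.
  - by rewrite -ler_pdivlMr ?mulr_gt0 // ge_min lexx.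
  - by rewrite -ler_pdivlMr ?mulr_gt0 // ge_min lexx orbT.
pose gam := 1 / (2 * (kappa - 1)).
have gam0 : 0 < gam by exact: gam_gt0.
pose u := noise_cst L Rad * (64 * C0%:R ^+ 2) `^ gam.
pose v := 2 * (16 * C%:R) `^ gam * 2 `^ (6 * gam + 4) +
  noise_cst L Rad * expR ((4 + gam) ^+ 2 / (4 * c)).
have u0 : 0 < u by rewrite mulr_gt0 // powR_gt0 // mulr_gt0 // exprn_gt0.
have v0 : 0 < v by rewrite addr_gt0 ?mulr_gt0 ?powR_gt0 ?mulr_gt0 ?expR_gt0.
(* [u] covers the small budgets and [v] the large ones. *)
exists 1, 1, (u + v), (6 * gam + 4); split=> //; [by rewrite addr_gt0|by lra|].
move=> n T delta n0 T0 d01 f [g [_ convf lipf _]] q orac xs xsmin xsR.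
apply: (success_gt1 tau0 tauL Rad0 n0 T0 d01 convf lipf xsmin xsR orac) => //; rewrite -/gam.
- by rewrite -/u lerDl ltW.
- by rewrite -/v lerDr ltW.
Qed.
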